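(* Let $v\in\mathcal{H}$ be the solution of the critic equation $Av=b$, $A\equiv A(\nu)$, and assume that $v=L_{\mathfrak{K}}p$ for some $p\in L^2(\Omega)$. Let $\mu=[\mu_1,\dots,\mu_m]^{\mathrm T}=Bv\in\mathcal{U}=\mathcal{U}_1\times\cdots\times\mathcal{U}_m$ be the solution of the actor step, i.e. $\mu(x)=-\tfrac12R^{-1}g^{\mathrm T}(x)\nabla v(x)$ and $\mu_i=B_iv\in\mathcal{U}_i$. Let $v_N^\delta\in H_N$ be the Galerkin approximation of the critic obtained from noisy data $b^\delta$ by Method (C1) or by Method (C2), as defined in the context, with $\delta=\|b-b^\delta\|_{\mathcal{W}}$ for Method (C1) and $\delta=\|b-b^\delta\|_{L^2(\Omega)}$ for Method (C2). Define the approximation of the actor step by $$\mu_{i,(M,N)}=\Pi_{U_{i,M}}B_iv_N^\delta,\qquad 1\le i\le m .$$ If the Galerkin approximations in the critic and actor steps are convergent, then there exist constants $C(N),C_u,C_v,C_v'>0$, where $C(N)$ may depend on $N$ but $C_u,C_v,C_v'$ do not depend on $N$, and none depends on $M$ or on $b^\delta$ (hence not on $\delta$), such that for all $1\le i\le m$ and all $M,N$ (with $N\ge N_0$) $$\|\mu_i-\mu_{i,(M,N)}\|_{L^\infty(\Omega)}\le C_u\sup_{\xi\in\Omega}\mathcal{P}_{U_{i,M}}(\xi)\,\|\mu_i\|_{\mathcal{U}_i}+C_v\|v-v_N^\delta\|_{\mathcal{H}}$$ $$\le C(N)\,\delta+C_v'\sup_{\xi\in\Omega}\mathcal{P}_{H_N}(\xi)\,\|L_{\mathfrak{K}}^{-1}v\|_{L^2(\Omega)}+C_u\sup_{\xi\in\Omega}\mathcal{P}_{U_{i,M}}(\xi)\,\|\mu_i\|_{\mathcal{U}_i},$$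 where $L_{\mathfrak{K}}^{-1}v$ denotes $p$.
   Context: Domain and kernel. $\Omega\subset\mathbb{R}^n$ is compact, simply connected, and equal to the closure of its interior. $\mathfrak{K}:\Omega\times\Omega\to\mathbb{R}$ is a symmetric, strictly positive kernel (Gram matrices of finitely many distinct points are positive definite), bounded on the diagonal, with $\mathfrak{K}\in C^{2s}(\Omega\times\Omega)$ for some integer $s\ge1$ (derivatives on $\Omega$ are continuous extensions from the interior). $\mathcal{H}$ is the reproducing kernel Hilbert space (RKHS) of real-valued functions on $\Omega$ with kernel $\mathfrak{K}$; $\mathfrak{K}_x=\mathfrak{K}(\cdot,x)$. Functions in $\mathcal{H}$ are $C^s$, and $D^{e_k}v(x)=(D^{(e_k,0)}\mathfrak{K}(x,\cdot),v)_{\mathcal{H}}$, where $e_k$ is the $k$-th unit multiindex and $D^{(\alpha,\beta)}\mathfrak{K}(x,y)$ denotes differentiation of order $\alpha$ in $x$ and $\beta$ in $y$. Critic operator. $f:\mathbb{R}^n\to\mathbb{R}^n$ and $g:\mathbb{R}^n\to\mathbb{R}^{n\times m}$ are given (dynamics $\dot x=f(x)+g(x)u$), and $\nu:\Omega\to\mathbb{R}^m$ is a fixed feedback law (the previous policy iterate). For $v\in\mathcal{H}$, $(Av)(x)=(f(x)+g(x)\nu(x))^{\mathrm T}\nabla v(x)=\sum_{k=1}^n a_k(x)D^{e_k}v(x)$ with $a_k=f_k+\sum_{j=1}^m g_{kj}\nu_j$. $\mathcal{N}(A)$, $\mathcal{R}(A)$ are the nullspace and range. $\mathcal{W}=\mathcal{R}(A)$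 is normed by $\|w\|_{\mathcal{W}}=\inf\{\|h\|_{\mathcal{H}}:Ah=w\}$; it is the RKHS with kernel $\mathfrak{w}(x,y)=\sum_{k,\ell=1}^n a_k(x)D^{(e_k,e_\ell)}\mathfrak{K}(x,y)a_\ell(y)$, with $\mathfrak{w}_\xi=\mathfrak{w}(\cdot,\xi)$. It is a standing assumption that $\mathcal{W}$ is continuously embedded in $C(\Omega)$, hence in $L^2(\Omega)$. The data $b$ belongs to $\mathcal{W}$. Critic Galerkin schemes. For each $N\ge N_0$, $\Xi_N=\{\xi_1,\dots,\xi_N\}\subset\Omega$ is a set of $N$ distinct centers and $H_N=\mathrm{span}\{\mathfrak{K}_{\xi_1},\dots,\mathfrak{K}_{\xi_N}\}\subset\mathcal{N}(A)^\perp$. Method (C1): $b^\delta\in\mathcal{W}$, $W_N=\mathrm{span}\{\mathfrak{w}_{\xi_1},\dots,\mathfrak{w}_{\xi_N}\}$, $\Pi_{W_N}$ is the $\mathcal{W}$-orthogonal projection onto $W_N$, $G_N=(\Pi_{W_N}A|_{H_N})^{-1}\Pi_{W_N}$, $v_N^\delta=G_Nb^\delta$. Method (C2): $b^\delta\in L^2(\Omega)$, $Y_N=\mathrm{span}\{A\mathfrak{K}_{\xi_1},\dots,A\mathfrak{K}_{\xi_N}\}$, $\Pi_{Y_N}$ is the $L^2(\Omega)$-orthogonal projection onto $Y_N$, $G_N=(\Pi_{Y_N}A|_{H_N})^{-1}\Pi_{Y_N}$, $v_N^\delta=G_Nb^\delta$. In either case the critic scheme is convergent if $G_N$ is well-defined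 for every $N\ge N_0$ and, for every $y\in\mathcal{R}(A)$, $G_Ny\to(A|_{\mathcal{N}(A)^\perp})^{-1}y$ in $\mathcal{H}$ as $N\to\infty$. Actor spaces. $R\in\mathbb{R}^{m\times m}$ is symmetric positive definite, $R^{-1}_{ij}=(R^{-1})_{ij}$. For $v\in\mathcal{H}$, $(Bv)(x)=-\tfrac12R^{-1}g^{\mathrm T}(x)\nabla v(x)$ with components $$(B_iv)(x)=-\tfrac12\sum_{j=1}^m\sum_{k=1}^nR^{-1}_{ij}g_{kj}(x)D^{e_k}v(x),\quad 1\le i\le m.$$ $\mathcal{U}_i=\mathcal{R}(B_i)$ is normed by $\|u\|_{\mathcal{U}_i}=\inf\{\|h\|_{\mathcal{H}}:B_ih=u\}$; it is the RKHS with kernel $$\mathfrak{u}_i(x,y)=\tfrac14\sum_{j,l=1}^m\sum_{k,t=1}^nR^{-1}_{ij}g_{kj}(x)\,D^{(e_k,e_t)}\mathfrak{K}(x,y)\,g_{tl}(y)R^{-1}_{il}.$$ It is a standing assumption that each $\mathfrak{u}_i$ is bounded on the diagonal: $\sup_{x\in\Omega}\mathfrak{u}_i(x,x)<\infty$. For each $M$, $\Omega_M=\{\omega_1,\dots,\omega_M\}\subset\Omega$ is a set of $M$ centers, $U_{i,M}=\mathrm{span}\{\mathfrak{u}_i(\cdot,\omega_k):1\le k\le M\}$, and $\Pi_{U_{i,M}}$ is the $\mathcal{U}_i$-orthogonal projection onto $U_{i,M}$. The actor approximation is convergent if $\Pi_{U_{i,M}}u\to u$ in $\mathcal{U}_i$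 as $M\to\infty$ for every $u\in\mathcal{U}_i$ and every $i$. Power functions and integral operator. For a finite-dimensional subspace $S$ of an RKHS with kernel $k$, the power function is $\mathcal{P}_S(x)=\sqrt{k(x,x)-k_S(x,x)}$, where $k_S$ is the reproducing kernel of $S$ (with the inherited inner product); $\mathcal{P}_{H_N}$ is that of $H_N\subset\mathcal{H}$ and $\mathcal{P}_{U_{i,M}}$ that of $U_{i,M}\subset\mathcal{U}_i$. $(L_{\mathfrak{K}}p)(x)=\int_\Omega\mathfrak{K}(x,y)p(y)\,dy$ for $p\in L^2(\Omega)$. *)

(* Defs.v *)
From HB Require Import structures.
From mathcomp Require Import all_boot all_order all_algebra.
From mathcomp Require Import all_classical all_reals all_analysis.

Set Implicit Arguments.
Unset Strict Implicit.
Unset Printing Implicit Defensive.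

Import Order.TTheory GRing.Theory Num.Theory.
Import numFieldNormedType.Exports.

Local Open Scope classical_set_scope.
Local Open Scope ring_scope.

(* The product sigma-algebra on matrices; over the reals it is the Borel
   sigma-algebra. *)
Definition measure_mx_display : measure_display -> measure_display.
Proof. exact. Qed.

Section measurable_mx.
Context {d} {T : measurableType d} (m n : nat).

Definition mx_cylinders : set (set 'M[T]_(m, n)) :=
  \bigcup_(ij in [set: 'I_m * 'I_n])
    preimage_set_system setT (fun A : 'M[T]_(m, n) => A ij.1 ij.2) measurable.

Let mx_set0 : <<s mx_cylinders >> set0.
Proof. exact: sigma_algebra0. Qed.

Let mx_setC A : <<s mx_cylinders >> A -> <<s mx_cylinders >> (~` A).
Proof. exact: sigma_algebraC. Qed.

Let mx_bigcup (F : (set 'M[T]_(m, n))^nat) :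
  (forall i, <<s mx_cylinders >> (F i)) -> <<s mx_cylinders >> (\bigcup_i F i).
Proof. exact: sigma_algebra_bigcup. Qed.

HB.instance Definition _ := @isMeasurable.Build (measure_mx_display d)
  'M[T]_(m, n) <<s mx_cylinders >> mx_set0 mx_setC mx_bigcup.

End measurable_mx.

Lemma measurable_mx_coord d (T : measurableType d) m n (i : 'I_m) (j : 'I_n) :
  measurable_fun [set: 'M[T]_(m, n)] (fun A : 'M[T]_(m, n) => A i j).
Proof.
move=> _ Y mY; apply: sub_sigma_algebra.
by exists (i, j) => //; exists Y.
Qed.

Lemma measurable_fun_mx d d' (S : measurableType d') (T : measurableType d)
    m n (F : S -> 'M[T]_(m, n)) :
  (forall i j, measurable_fun setT (fun x => F x i j)) -> measurable_fun setT F.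
Proof.
move=> mF; apply: (@measurability _ _ _ _ setT F (@mx_cylinders _ T m n)) => //.
move=> _ [_ [[i j] _ [Y mY <-]] <-].
by rewrite setTI; apply: (mF i j).
Qed.


Section lebesgue_cV.
Context {R : realType}.

Definition cons_cV n (z : measurableTypeR R * 'cV[R]_n) : 'cV[R]_n.+1 :=
  \col_i oapp (fun j => z.2 j 0) z.1 (unlift ord0 i).

Definition uncons_cV n (x : 'cV[R]_n.+1) : measurableTypeR R * 'cV[R]_n :=
  (x ord0 0, \col_j x (lift ord0 j) 0).

Lemma cons_cVK n : cancel (@cons_cV n) (@uncons_cV n).
Proof.
case=> a y; rewrite /uncons_cV /cons_cV mxE unlift_none /=; congr pair.
by apply/colP => j; rewrite !mxE liftK.
Qed.

Lemma measurable_cons_cV n : measurable_fun setT (@cons_cV n).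
Proof.
apply: measurable_fun_mx => i j; rewrite {j}ord1.
rewrite (_ : (fun _ => _) = fun z : measurableTypeR R * 'cV[R]_n =>
  oapp (fun j => z.2 j 0) z.1 (unlift ord0 i)); last first.
  by apply/funext => z; rewrite mxE.
case: (unlift ord0 i) => [j|] /=; last exact: measurable_fst.
apply: (measurableT_comp (measurable_mx_coord _ _)); exact: measurable_snd.
Qed.

Lemma measurable_uncons_cV n : measurable_fun setT (@uncons_cV n).
Proof.
apply: measurable_fun_pair => /=; first exact: measurable_mx_coord.
apply: measurable_fun_mx => i j.
rewrite (_ : (fun _ => _) = fun x : 'cV[R]_n.+1 => x (lift ord0 i) 0).
  exact: measurable_mx_coord.
by apply/funext => x; rewrite mxE.
Qed.

Section step.
Variables (n : nat) (mu : {sigma_finite_measure set 'cV[R]_n -> \bar R}).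

Definition lebesgue_step : set 'cV[R]_n.+1 -> \bar R :=
  pushforward (lebesgue_measure \x mu)%E (@cons_cV n).

Let mcons := @measurable_cons_cV n.

Let lebesgue_step0 : lebesgue_step set0 = 0%E.
Proof. by rewrite /lebesgue_step /pushforward preimage_set0 measure0. Qed.

Let lebesgue_step_ge0 A : (0 <= lebesgue_step A)%E.
Proof. exact: (@measure_ge0 _ _ _ (lebesgue_measure \x mu)%E). Qed.

Let lebesgue_step_sigma_additive : semi_sigma_additive lebesgue_step.
Proof.
exact: (@measure_semi_sigma_additive _ _ _
  (measure_function_pushforward__canonical__measure_function_Measure
    (lebesgue_measure \x mu)%E mcons)).
Qed.

HB.instance Definition _ := isMeasure.Build _ _ _ lebesgue_step
  lebesgue_step0 lebesgue_step_ge0 lebesgue_step_sigma_additive.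

Let lebesgue_step_sigma_finite : sigma_finite setT lebesgue_step.
Proof.
have /sigma_finiteP[F [FT ndF Foo]] := sigma_finiteT (@lebesgue_measure R).
have /sigma_finiteP[G [GT ndG Goo]] := sigma_finiteT mu.
exists (fun k => @uncons_cV n @^-1` (F k `*` G k)).
  rewrite -preimage_bigcup (_ : \bigcup_k _ = setT) ?preimage_setT//.
  apply/seteqP; split => // -[x y] _.
  have [i _ Fx] : (\bigcup_i F i) x by rewrite -FT.
  have [j _ Gy] : (\bigcup_i G i) y by rewrite -GT.
  exists (maxn i j) => //; split => /=.
    by move: x Fx; exact/subsetPset/ndF/leq_maxl.
  by move: y Gy; exact/subsetPset/ndG/leq_maxr.
move=> k; have [mF Fk] := Foo k; have [mG Gk] := Goo k; split.
  rewrite -[X in measurable X]setTI; apply: measurable_uncons_cV => //.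
  exact: measurableX.
rewrite /lebesgue_step /pushforward -comp_preimage.
rewrite (_ : _ \o _ = id); last by rewrite funeqE => z /=; rewrite cons_cVK.
rewrite preimage_id product_measure1E//.
by rewrite lte_mul_pinfty// ge0_fin_numE.
Qed.

HB.instance Definition _ := Measure_isSigmaFinite.Build _ _ _ lebesgue_step
  lebesgue_step_sigma_finite.

End step.

(* Lebesgue measure on R^n: the n-fold product of the Lebesgue measure on R,
   transported along cons_cV : R * R^n -> R^(n+1). *)
Fixpoint lebesgue_cV (n : nat) :
    {sigma_finite_measure set 'cV[R]_n -> \bar R} :=
  match n with
  | 0 => \d_(0 : 'cV[R]_0)
  | n'.+1 => lebesgue_step (lebesgue_cV n')
  end.

End lebesgue_cV.

Section domains.
Context {R : realType}.

Definition simply_connected (T : topologicalType) (A : set T) : Prop :=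
  let I : set R := `[0, 1]%classic in
  let path_in (p : R -> T) :=
    {within I, continuous p} /\ (forall t, I t -> A (p t)) in
  [/\ A !=set0,
      forall x y, A x -> A y -> exists p, [/\ path_in p, p 0 = x & p 1 = y] &
      forall p, path_in p -> p 0 = p 1 ->
        exists h : R * R -> T,
          [/\ {within I `*` I, continuous h},
              forall z, (I `*` I) z -> A (h z),
              forall t, I t -> h (t, 0) = p t /\ h (t, 1) = p 0 &
              forall r, I r -> h (0, r) = p 0 /\ h (1, r) = p 0]].

Context {V : normedModType R}.

(* The directional derivative along e, extended from the interior of D to D by
   continuity. *)
Definition dext (D : set V) (e : V) (f : V -> R) : V -> R :=
  fun x => lim ('D_e f y @[y --> within D° (nbhs x)]).

(* The derivatives along the directions e j, up to order k, exist in the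
   interior of D and extend continuously to D. *)
Fixpoint Ck_on (J : Type) (e : J -> V) (D : set V) (k : nat) (f : V -> R) :
    Prop :=
  {within D, continuous f} /\
  if k is k'.+1 then
    forall j, exists2 df : V -> R,
      (forall x, D° x -> is_derive x (e j) f (df x)) & Ck_on e D k' df
  else True.

End domains.

Section kernels.
Context {R : realType} {n : nat}.
Notation T := 'cV[R]_n.
Implicit Types (Omega : set T) (k K : T -> T -> R) (v : T -> R).

Definition unit_vec (i : 'I_n) : T := delta_mx i 0.

Definition unit_vec2 (j : 'I_n + 'I_n) : T * T :=
  match j with inl i => (unit_vec i, 0) | inr i => (0, unit_vec i) end.

Definition partial Omega (i : 'I_n) v : T -> R := dext Omega (unit_vec i) v.

Definition grad Omega v (x : T) : T := \col_i partial Omega i v x.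

(* D^(e_i, e_j) K (x, y) *)
Definition partial2 Omega K (i j : 'I_n) (x y : T) : R :=
  let D := Omega `*` Omega in
  dext D (unit_vec2 (inl i))
    (dext D (unit_vec2 (inr j)) (fun z => K z.1 z.2)) (x, y).

Definition posdef (N : nat) (G : 'M[R]_N) : Prop :=
  forall c : 'cV[R]_N, c != 0 -> 0 < (c^T *m G *m c) 0 0.

Definition strictly_positive Omega K : Prop :=
  forall (N : nat) (x : 'I_N -> T), injective x -> (forall j, Omega (x j)) ->
    posdef (\matrix_(i, j) K (x i) (x j)).

Definition bounded_diagonal Omega k : Prop :=
  exists c : R, forall x, Omega x -> k x x <= c.

(* Functions on Omega are represented by functions on R^n vanishing off Omega,
   so that equality of functions on Omega is Leibniz equality. *)
Definition ksec Omega k (y : T) : T -> R := (k ^~ y) \_ Omega.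

(* The Hilbert space H, whose element h is the function ev h on Omega, is the
   reproducing kernel Hilbert space of K. *)
Record is_rkhs Omega K (H : completeNormedModType R) (dot : {dot H for idfun})
    (ev : H -> T -> R) : Prop := IsRKHS {
  rkhs_norm : forall h, dot h h = `|h| ^+ 2 ;
  rkhs_linear : forall a h h' x, ev (a *: h + h') x = a * ev h x + ev h' x ;
  rkhs_support : forall h x, ~ Omega x -> ev h x = 0 ;
  rkhs_inj : injective ev ;
  rkhs_repr : forall y, Omega y ->
    exists2 Ky, ev Ky = ksec Omega K y & forall h, dot h Ky = ev h y
}.

End kernels.

Section hilbert.
Context {R : realType}.

Definition lspan (V : lmodType R) N (e : 'I_N -> V) : set V :=
  [set x | exists c : 'I_N -> R, x = \sum_j c j *: e j].

Definition orth_proj (F : zmodType) (dot : F -> F -> R) (S : set F) (y : F) : F :=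
  xget 0 [set p | S p /\ forall s, S s -> dot (y - p) s = 0].

Section quotient.
Context {H : normedModType R} {F : zmodType}.
Implicit Types (A : H -> F) (dot : H -> H -> R).

Definition nullspace A : set H := [set h | A h = 0].

Definition orthocomplement dot (S : set H) : set H :=
  [set h | forall s, S s -> dot h s = 0].

(* The norm of the range of A; its inner product is recovered by
   polarization. *)
Definition qnorm A (w : F) : R := inf [set `|h| | h in [set h | A h = w]].

Definition qdot A (w w' : F) : R :=
  (qnorm A (w + w') ^+ 2 - qnorm A (w - w') ^+ 2) / 4.

Definition range_inv dot A : F -> H :=
  'pinv_(fun=> 0) (orthocomplement dot (nullspace A)) A.

(* (P A|_S)^-1 P *)
Definition galerkin A (S : set H) (P : F -> F) (y : F) : H :=
  'pinv_(fun=> 0) S (P \o A) (P y).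

Definition galerkin_convergent dot A (N0 : nat) (S : nat -> set H)
    (Y : nat -> set F) (P : nat -> F -> F) : Prop :=
  (forall N, (N0 <= N)%N -> set_bij (S N) (Y N) (P N \o A)) /\
  (forall y, range A y ->
    galerkin A (S N) (P N) y @[N --> \oo] --> range_inv dot A y).

End quotient.

Context {n : nat}.
Notation T := 'cV[R]_n.

(* The value at (x, y) of the reproducing kernel of S is ev (sub_ksec S y) x. *)
Definition sub_ksec (F : zmodType) (dot : F -> F -> R) (ev : F -> T -> R)
    (S : set F) (y : T) : F :=
  xget 0 [set ky | S ky /\ forall s, S s -> dot s ky = ev s y].

Definition power_function (F : zmodType) (dot : F -> F -> R)
    (ev : F -> T -> R) (k : T -> T -> R) (S : set F) (x : T) : R :=
  Num.sqrt (k x x - ev (sub_ksec dot ev S x) x).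

End hilbert.

Section L2.
Context {R : realType} {n : nat}.
Notation T := 'cV[R]_n.
Notation mu := (lebesgue_cV n).
Implicit Types (Omega : set T) (u w p : T -> R).

Definition L2 Omega : set (T -> R) := [set u | u \_ Omega \in Lfun mu 2%:E].

Definition L2dot Omega u w : R := \int[mu]_(x in Omega) (u x * w x).

Definition L2norm Omega u : R := fine ('N[mu]_2%:E[EFin \o (u \_ Omega)])%E.

Definition Linfty_norm Omega u : \bar R := 'N[mu]_+oo[EFin \o (u \_ Omega)]%E.

Definition integral_op Omega (K : T -> T -> R) p : T -> R :=
  (fun x => \int[mu]_(y in Omega) (K x y * p y)) \_ Omega.

End L2.

Section operators.
Context {R : realType} {n m : nat}.
Notation T := 'cV[R]_n.
Implicit Types (Omega : set T) (K : T -> T -> R) (v : T -> R) (Rm : 'M[R]_m).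
Implicit Types (f a : T -> T) (g : T -> 'M[R]_(n, m)) (nu : T -> 'cV[R]_m).

Definition closed_loop f g nu : T -> T := fun x => f x + g x *m nu x.

Definition critic_op Omega a v : T -> R :=
  (fun x => ((a x)^T *m grad Omega v x) 0 0) \_ Omega.

Definition critic_kernel Omega K a (x y : T) : R :=
  \sum_k \sum_l a x k 0 * partial2 Omega K k l x y * a y l 0.

Definition actor_op Omega g Rm (i : 'I_m) v : T -> R :=
  (fun x => (- 2^-1 *: (invmx Rm *m (g x)^T *m grad Omega v x)) i 0) \_ Omega.

Definition actor_kernel Omega K g Rm (i : 'I_m) (x y : T) : R :=
  4^-1 * \sum_j \sum_l \sum_k \sum_t
    invmx Rm i j * g x k j * partial2 Omega K k t x y * g y t l * invmx Rm i l.

End operators.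

(* C1 projects the critic equation in the native space of the range of A,
   C2 projects it in L2. *)
Variant critic_method := C1 | C2.

Section methods.
Context {R : realType} {n : nat} {H : normedModType R}.
Notation T := 'cV[R]_n.
Variables (Omega : set T) (K : T -> T -> R) (a : T -> T) (ev : H -> T -> R).
Let A (h : H) : T -> R := critic_op Omega a (ev h).

Definition data_space (meth : critic_method) : set (T -> R) :=
  match meth with C1 => range A | C2 => L2 Omega end.

Definition data_dot (meth : critic_method) : (T -> R) -> (T -> R) -> R :=
  match meth with C1 => qdot A | C2 => L2dot Omega end.

Definition data_norm (meth : critic_method) : (T -> R) -> R :=
  match meth with C1 => qnorm A | C2 => L2norm Omega end.

Definition trial_space N (xi : 'I_N -> T) : set H :=
  [set h | lspan (fun j => ksec Omega K (xi j)) (ev h)].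

Definition test_space (meth : critic_method) N (xi : 'I_N -> T) :
    set (T -> R) :=
  match meth with
  | C1 => lspan (fun j => ksec Omega (critic_kernel Omega K a) (xi j))
  | C2 => lspan (fun j => critic_op Omega a (ksec Omega K (xi j)))
  end.

End methods.

(* Main.v *)
(* Both operators have the form h |-> (x |-> <h, al x>) for vectors al x of H,
   because the derivatives of the kernel sections exist in H up to the boundary.
   Hence the range with the quotient norm is isometric to the orthogonal
   complement of the null space, with reproducing kernel <al x, al y>.

   First inequality: mu - Pi (B vN) = (mu - Pi mu) + Pi (B (v - vN)); evaluation
   at x is bounded by the power function on the first term and by the square
   root of the kernel diagonal on the second.

   Second inequality: G_N is bounded for each N, which yields C(N) delta, and
   the operators G_N A are bounded uniformly in N by Banach-Steinhaus.  Since
   G_N A is the identity on H_N, with e = v - Pi_{H_N} v,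
   |v - G_N A v| = |e - G_N A e| <= (1 + M) |e|, where v need not be orthogonal
   to the null space of A.  Finally |e|^2 = <e, L_K p> = \int e p, and
   |e x| <= |e| P_{H_N} x. *)

Require Import Defs.
From mathcomp Require Import all_boot all_order all_algebra.
From mathcomp Require Import all_classical all_reals all_analysis.
From mathcomp Require Import measurable_realfun ess_sup_inf ring lra.
Import Order.TTheory GRing.Theory Num.Theory.
Import numFieldNormedType.Exports.

Set Implicit Arguments.
Unset Strict Implicit.
Unset Printing Implicit Defensive.

Local Open Scope classical_set_scope.
Local Open Scope ring_scope.

(** * Positive semidefinite forms and Gram-Schmidt projections *)

Section submodules.
Context {R : realType} {V : lmodType R}.

(** Only [H] is available as a complete space. The data live in sets of functions: the range of an
    operator under a quotient norm, whose inner product comes from polarization, or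
    square-integrable functions that are not identified almost everywhere. Projections are therefore
    built by Gram-Schmidt for a semidefinite form on a subspace. Such a projection is a chosen
    element, and it depends linearly on its argument once the form is definite on the finite span.
    For C1 the native inner product gives this; for C2 it has to be drawn from the injectivity that
    well-posedness of the scheme provides. Banach-Steinhaus is applied to G_N A rather than G_N, so
    that the domain is the complete space [H]. The vectors representing derivatives arise from two
    limits, of difference quotients in the interior and then of interior points tending to the
    boundary. Both exist because the Gram values converge, being values of one continuous mixed
    derivative. In the result Cu is 1, Cv bounds the square roots of the actor kernel diagonals, and
    sqrt(vol Omega) enters Cv' through the L2 norm of [e]. *)

Definition linear_subspace (S : set V) : Prop :=
  S 0 /\ forall a x y, S x -> S y -> S (a *: x + y).

Variable S : set V.
Hypothesis S_sub : linear_subspace S.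

Lemma subspaceZ a x : S x -> S (a *: x).
Proof.
by move=> Sx; rewrite -[_ *: _]addr0; apply: S_sub.2 => //; exact: S_sub.1.
Qed.

Lemma subspaceD x y : S x -> S y -> S (x + y).
Proof. by move=> Sx Sy; rewrite -[x]scale1r; exact: S_sub.2. Qed.

Lemma subspaceB x y : S x -> S y -> S (x - y).
Proof. by move=> Sx Sy; rewrite addrC -scaleN1r; exact: S_sub.2. Qed.

Lemma subspace_sum (I : finType) (F : I -> V) :
  (forall i, S (F i)) -> S (\sum_i F i).
Proof. by move=> SF; elim/big_ind : _ => //; [exact: S_sub.1|exact: subspaceD]. Qed.

Lemma lspan_sub N (e : 'I_N -> V) : (forall j, S (e j)) -> lspan e `<=` S.
Proof.
by move=> Se x [c ->]; apply: subspace_sum => j; apply: subspaceZ.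
Qed.

End submodules.

Lemma subspace_lspan (R : realType) (V : lmodType R) N (e : 'I_N -> V) :
  linear_subspace (lspan e).
Proof.
split; first by exists (fun=> 0); rewrite big1// => j _; rewrite scale0r.
move=> a _ _ [c ->] [d ->]; exists (fun j => a * c j + d j).
rewrite scaler_sumr -big_split/=; apply: eq_bigr => j _.
by rewrite scalerDl scalerA.
Qed.

Lemma lspan_mem (R : realType) (V : lmodType R) N (e : 'I_N -> V) j :
  lspan e (e j).
Proof.
exists (fun i => (i == j)%:R); rewrite (bigD1 j)//= eqxx scale1r big1 ?addr0//.
by move=> i /negbTE ->; rewrite scale0r.
Qed.

Lemma lspan_eq (R : realType) (V : lmodType R) N (e e' : 'I_N -> V) :
  e =1 e' -> lspan e = lspan e'.
Proof. by move=> /funext ->. Qed.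

Section psd_forms.
Context {R : realType} {V : lmodType R}.

(** The domain [D] is explicit because both data forms are defined on all functions but behave
    bilinearly only on a subspace: integrals need square integrability, the polarized quotient norm
    needs the range. *)
Record psd_form (D : set V) (q : V -> V -> R) : Prop := PsdForm {
  psd_sub : linear_subspace D ;
  psdC : forall x y, D x -> D y -> q x y = q y x ;
  psd_linear : forall a x y z, D x -> D y -> D z ->
    q (a *: x + y) z = a * q x z + q y z ;
  psd_ge0 : forall x, D x -> 0 <= q x x }.

Variables (D : set V) (q : V -> V -> R).
Hypothesis qD : psd_form D q.

Let sub := psd_sub qD.
Let D0 := sub.1.

Lemma psd0l x : D x -> q 0 x = 0.
Proof.
by move=> Dx; have := psd_linear qD 1 D0 D0 Dx; rewrite scaler0 addr0; lra.
Qed.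

Lemma psdZl a x y : D x -> D y -> q (a *: x) y = a * q x y.
Proof.
by move=> Dx Dy; have := psd_linear qD a Dx D0 Dy; rewrite addr0 psd0l// addr0.
Qed.

Lemma psdDl x y z : D x -> D y -> D z -> q (x + y) z = q x z + q y z.
Proof. by move=> Dx Dy Dz; rewrite -[x]scale1r (psd_linear qD)// !scale1r mul1r. Qed.

Lemma psdBl x y z : D x -> D y -> D z -> q (x - y) z = q x z - q y z.
Proof.
by move=> Dx Dy Dz; rewrite addrC -scaleN1r (psd_linear qD)// mulN1r addrC.
Qed.

Lemma psd_suml (I : finType) (F : I -> V) y : (forall i, D (F i)) -> D y ->
  q (\sum_i F i) y = \sum_i q (F i) y.
Proof.
move=> DF Dy.
apply: (@proj2 (D (\sum_i F i))).
elim/big_rec2 : _ => [|i r z _ [Dz IH]]; first by rewrite psd0l.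
by rewrite psdDl// IH; split=> //; apply: (subspaceD sub).
Qed.

Lemma psd0r x : D x -> q x 0 = 0.
Proof. by move=> Dx; rewrite (psdC qD)// psd0l. Qed.

Lemma psdDr x y z : D x -> D y -> D z -> q x (y + z) = q x y + q x z.
Proof.
move=> Dx Dy Dz; rewrite (psdC qD)// ?psdDl//; last exact: (subspaceD sub).
by rewrite (psdC qD Dx Dy)// (psdC qD Dx Dz).
Qed.

Lemma psdZr a x y : D x -> D y -> q x (a *: y) = a * q x y.
Proof.
move=> Dx Dy; rewrite (psdC qD)// ?psdZl//; last exact: (subspaceZ sub).
by rewrite (psdC qD Dx Dy).
Qed.

Lemma psdBr x y z : D x -> D y -> D z -> q x (y - z) = q x y - q x z.
Proof.
move=> Dx Dy Dz; rewrite (psdC qD)// ?psdBl//; last exact: (subspaceB sub).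
by rewrite (psdC qD Dx Dy)// (psdC qD Dx Dz).
Qed.

Lemma psd_cauchy_schwarz x y : D x -> D y -> q x y ^+ 2 <= q x x * q y y.
Proof.
move=> Dx Dy.
have key a b : 0 <= a ^+ 2 * q x x - 2 * (a * b) * q x y + b ^+ 2 * q y y.
  have Dax : D (a *: x) by apply: (subspaceZ sub).
  have Dby : D (b *: y) by apply: (subspaceZ sub).
  have := psd_ge0 qD (subspaceB sub Dax Dby).
  rewrite psdBl//; last exact: (subspaceB sub).
  rewrite !psdBr// !psdZl// !psdZr// (psdC qD Dx Dy)//.
  by move/le_trans; apply; rewrite le_eqVlt; apply/orP; left; apply/eqP; ring.
have x0 := psd_ge0 qD Dx; have y0 := psd_ge0 qD Dy.
have [yy|yy] := eqVneq (q y y) 0.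
  rewrite yy mulr0; have [->|xy] := eqVneq (q x y) 0; first by rewrite expr0n.
  (* The form is linear in [b] when [q y y = 0]; this [b] makes its value exactly [- q x y ^+ 2]. *)
  have := key (q x y) ((q x x + 1) / 2); rewrite yy mulr0 addr0.
  have -> : q x y ^+ 2 * q x x - 2 * (q x y * ((q x x + 1) / 2)) * q x y =
    - q x y ^+ 2 by field.
  by rewrite oppr_ge0.
have {}yy : 0 < q y y by rewrite lt_def yy.
rewrite -subr_ge0 -(pmulr_rge0 _ yy).
apply: le_trans (key (q y y) (q x y)) _.
by rewrite le_eqVlt; apply/orP; left; apply/eqP; ring.
Qed.

Lemma psd_null x y : D x -> D y -> q x x = 0 -> q x y = 0.
Proof.
move=> Dx Dy xx; apply/eqP; rewrite -sqrf_eq0 eq_le sqr_ge0 andbT.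
by rewrite (le_trans (psd_cauchy_schwarz Dx Dy))// xx mul0r.
Qed.

(* Gram-Schmidt: the f j are orthonormal, up to zero vectors when the e j are
   dependent modulo the null space of q. *)
Lemma psd_projection N (e : 'I_N -> V) : (forall j, D (e j)) ->
  exists f : 'I_N -> V, (forall j, lspan e (f j)) /\
    forall y s, D y -> lspan e s -> q (y - \sum_j q y (f j) *: f j) s = 0.
Proof.
elim: N e => [|N IH] e De.
  exists e; split=> [[]//|y _ Dy [c ->]]; rewrite !big_ord0.
  by rewrite psd0r// subr0.
pose e' j := e (lift ord0 j).
have [f' [f'e' f'P]] := IH e' (fun=> De _).
have e'D : lspan e' `<=` D by apply: lspan_sub => // j; exact: De.
have e'e : lspan e' `<=` lspan e.
  by apply: (lspan_sub (subspace_lspan e)) => j; exact: lspan_mem.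
have Df' j : D (f' j) by apply/e'D/f'e'.
pose P y := \sum_j q y (f' j) *: f' j.
have e'P y : lspan e' (P y).
  by apply: (subspace_sum (subspace_lspan e')) => j;
    apply: (subspaceZ (subspace_lspan e')); exact: f'e'.
have DP y : D (P y) by exact: e'D.
pose r := e ord0 - P (e ord0).
have Dr : D r by apply: (subspaceB sub) => //; exact: De.
have er : lspan e r.
  by apply: (subspaceB (subspace_lspan e)); [exact: lspan_mem|exact: e'e].
have r_perp s : lspan e' s -> q r s = 0 by move=> ?; exact: f'P.
(* If [q r r = 0], the inverse is 0 by convention and [f0] vanishes, so the dependent case has the
   same formula. *)
pose f0 := (Num.sqrt (q r r))^-1 *: r.
have Df0 : D f0 by exact: (subspaceZ sub).
exists (fun i => oapp f' f0 (unlift ord0 i)); split.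
  move=> i; case: (unlift ord0 i) => [j|] /=; first exact/e'e/f'e'.
  exact: (subspaceZ (subspace_lspan e)).
move=> y s Dy [c ->].
rewrite !big_ord_recl/= unlift_none/=.
under eq_bigr do rewrite liftK/=.
rewrite -/(P y).
have -> : c ord0 *: e ord0 + \sum_(i < N) c (lift ord0 i) *: e (lift ord0 i) =
    c ord0 *: r + (c ord0 *: P (e ord0) + \sum_(i < N) c (lift ord0 i) *: e' i).
  by rewrite addrA -scalerDr /r subrK.
set s' := c ord0 *: P (e ord0) + _.
have s'e : lspan e' s'.
  apply: ((subspace_lspan e').2 (c ord0) _ _ (e'P _)).
  apply: (subspace_sum (subspace_lspan e')) => j.
  by apply: (subspaceZ (subspace_lspan e')); exact: lspan_mem.
have Ds' : D s' by exact: e'D.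
have Dyf : D (q y f0 *: f0) by exact: (subspaceZ sub).
have Dcr : D (c ord0 *: r) by exact: (subspaceZ sub).
have DyP : D (y - P y) by exact: (subspaceB sub).
rewrite opprD addrCA -[LHS]/(q (- _ + (y - P y)) _) addrC.
rewrite psdDr//; last exact: (subspaceB sub).
have -> : q (y - P y - q y f0 *: f0) s' = 0.
  have f0s' : q f0 s' = 0.
    rewrite /f0 psdZl//.
    by rewrite (r_perp _ s'e) mulr0.
  by rewrite psdBl// (f'P _ _ Dy s'e) psdZl// f0s' mulr0 subr0.
rewrite psdZr//; last exact: (subspaceB sub).
have f0r : q f0 r = (Num.sqrt (q r r))^-1 * q r r by rewrite /f0 psdZl.
have yf0 : q y f0 = (Num.sqrt (q r r))^-1 * q y r by rewrite /f0 psdZr.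
rewrite psdBl// psdBl// psdZl// f0r yf0.
rewrite (psdC qD (DP y) Dr) (r_perp _ (e'P y)).
suff -> : q y r - 0 -
    (Num.sqrt (q r r))^-1 * q y r * ((Num.sqrt (q r r))^-1 * q r r) = 0.
  by rewrite mulr0 addr0.
have [rr|rr] := eqVneq (q r r) 0.
  by rewrite (psdC qD)// psd_null// rr; lra.
have := sqr_sqrtr (psd_ge0 qD Dr); move: rr; set t := q r r; set w := Num.sqrt t.
move=> t0 wt; have w0 : w != 0.
  by apply: contra_neq t0 => w0; rewrite -wt w0 expr0n.
by rewrite -wt; field.
Qed.

End psd_forms.

(** * Hilbert spaces *)

Section hilbert_space.
Context {R : realType} {H : completeNormedModType R} (dot : {dot H for idfun}).
Hypothesis dot_norm : forall h, dot h h = `|h| ^+ 2.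

Lemma dot_psd : psd_form [set: H] dot.
Proof.
split=> // [x y _ _|a x y z _ _ _|x _].
- by rewrite hermC expr0 mul1r.
- by rewrite linearPl.
- by rewrite dot_norm sqr_ge0.
Qed.

Lemma dotC x y : dot x y = dot y x. Proof. exact: (psdC dot_psd). Qed.

Lemma dotDl x y z : dot (x + y) z = dot x z + dot y z.
Proof. exact: (psdDl dot_psd). Qed.

Lemma dotBl x y z : dot (x - y) z = dot x z - dot y z.
Proof. exact: (psdBl dot_psd). Qed.

Lemma dotZl a x y : dot (a *: x) y = a * dot x y.
Proof. exact: (psdZl dot_psd). Qed.

Lemma dotDr x y z : dot x (y + z) = dot x y + dot x z.
Proof. exact: (psdDr dot_psd). Qed.

Lemma dotBr x y z : dot x (y - z) = dot x y - dot x z.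
Proof. exact: (psdBr dot_psd). Qed.

Lemma dotZr a x y : dot x (a *: y) = a * dot x y.
Proof. exact: (psdZr dot_psd). Qed.

Lemma dot0l x : dot 0 x = 0. Proof. exact: (psd0l dot_psd). Qed.

Lemma dot0r x : dot x 0 = 0. Proof. exact: (psd0r dot_psd). Qed.

Lemma dot_sumr (I : finType) x (F : I -> H) :
  dot x (\sum_i F i) = \sum_i dot x (F i).
Proof.
rewrite dotC (psd_suml dot_psd)//; apply: eq_bigr => i _; exact: dotC.
Qed.

Lemma dot_eq0 x : dot x x = 0 -> x = 0.
Proof. by rewrite dot_norm => /eqP; rewrite sqrf_eq0 normr_eq0 => /eqP. Qed.

Lemma le_dot_norm x y : `|dot x y| <= `|x| * `|y|.
Proof.
rewrite -(@ler_pXn2r _ 2)// ?nnegrE ?mulr_ge0// real_normK ?num_real//.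
by rewrite exprMn -!dot_norm; exact: (psd_cauchy_schwarz dot_psd).
Qed.

Lemma normB_dot x y : `|x - y| ^+ 2 = dot x x - 2 * dot x y + dot y y.
Proof.
rewrite -dot_norm dotBl !dotBr (dotC y x); ring.
Qed.

(** Cauchy criterion: |f a - f s|^2 = <f a, f a> - 2 <f a, f s> + <f s, f s>, and the three Gram
    values are all close to [c]. A tolerance of e^2 / 4 on each suffices, the middle one counting
    twice. The limit of [f] need not be known in advance. *)
Lemma gram_cvg (T : Type) (F : set_system T) {FF : ProperFilter F} (f : T -> H)
    (c : R) :
  (fun p => dot (f p.1) (f p.2)) @ filter_prod F F --> c -> cvg (f @ F).
Proof.
move=> fc; apply/cauchy_cvgP/cauchy_exP => e e0.
have e4 : 0 < e ^+ 2 / 4 by rewrite divr_gt0// exprn_gt0.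
move/cvgrPdist_lt : fc => /(_ _ e4)[[P Q] /= [FP FQ] PQ].
have FPQ : F (P `&` Q) by exact: filterI.
have [a [Pa Qa]] := filter_ex FPQ.
exists (f a); near=> s.
have [Ps Qs] : (P `&` Q) s by near: s; exact: FPQ.
rewrite -ball_normE/= -(@ltr_pXn2r _ 2)// ?nnegrE ?(ltW e0)// normB_dot.
have /= := PQ (a, a) (conj Pa Qa); rewrite ltr_norml => /andP[aa1 aa2].
have /= := PQ (a, s) (conj Pa Qs); rewrite ltr_norml => /andP[as1 as2].
have /= := PQ (s, s) (conj Ps Qs); rewrite ltr_norml => /andP[ss1 ss2].
lra.
Unshelve. all: by end_near. Qed.

Lemma dot_cvg (T : Type) (F : set_system T) {FF : Filter F} (f g : T -> H) x y :
  f @ F --> x -> g @ F --> y -> dot (f t) (g t) @[t --> F] --> dot x y.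
Proof.
move=> fx gy.
have -> : (fun t => dot (f t) (g t)) =
    (fun t => dot (f t - x) (g t - y) + dot x (g t - y) + dot (f t - x) y + dot x y).
  by apply/funext => t; rewrite !dotBl !dotBr; ring.
rewrite -[X in _ --> X]add0r; apply: cvgD; last exact: cvg_cst.
have nx : `|f t - x| @[t --> F] --> (0 : R).
  by rewrite -(normr0 H) -(subrr x); apply: cvg_norm; apply: cvgB => //; exact: cvg_cst.
have ny : `|g t - y| @[t --> F] --> (0 : R).
  by rewrite -(normr0 H) -(subrr y); apply: cvg_norm; apply: cvgB => //; exact: cvg_cst.
rewrite -[X in _ --> X]addr0; apply: cvgD.
  rewrite -[X in _ --> X]addr0; apply: cvgD.
    apply: norm_cvg0.
    apply: (@squeeze_cvgr _ _ _ _ (fun=> 0) (fun t => `|f t - x| * `|g t - y|)).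
    - by near=> t; rewrite normr_ge0 le_dot_norm.
    - exact: cvg_cst.
    - by rewrite -(mulr0 0); exact: cvgM.
  apply: norm_cvg0.
  apply: (@squeeze_cvgr _ _ _ _ (fun=> 0) (fun t => `|x| * `|g t - y|)).
  - by near=> t; rewrite normr_ge0 le_dot_norm.
  - exact: cvg_cst.
  - by rewrite -(mulr0 `|x|); apply: cvgM => //; exact: cvg_cst.
apply: norm_cvg0.
apply: (@squeeze_cvgr _ _ _ _ (fun=> 0) (fun t => `|f t - x| * `|y|)).
- by near=> t; rewrite normr_ge0 le_dot_norm.
- exact: cvg_cst.
- by rewrite -(mul0r `|y|); apply: cvgM => //; exact: cvg_cst.
Unshelve. all: by end_near. Qed.

Lemma dot_cvg_prod (T U : Type) (F : set_system T) (G : set_system U)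
    {FF : Filter F} {GG : Filter G} (f : T -> H) (g : U -> H) x y :
  f @ F --> x -> g @ G --> y ->
  (fun p => dot (f p.1) (g p.2)) @ filter_prod F G --> dot x y.
Proof.
move=> fx gy; apply: dot_cvg.
  by apply: cvg_comp fx; exact: cvg_fst.
by apply: cvg_comp gy; exact: cvg_snd.
Qed.

Lemma closed_projection (S : set H) : linear_subspace S -> closed S ->
  forall x, exists p, S p /\ forall s, S s -> dot (x - p) s = 0.
Proof.
move=> Ssub Scl x.
pose D := [set `|x - s| | s in S].
have D0 : D !=set0 by exists `|x - 0|, 0 => //; exact: Ssub.1.
have lbD : lbound D 0 by move=> _ [s _ <-].
have hD : has_inf D by split => //; exists 0.
pose d := inf D.
have d0 : 0 <= d by exact: lb_le_inf.
have dS s : S s -> d <= `|x - s| by move=> Ss; apply: ge_inf; [exists 0|exists s].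
have ex n : exists s, S s /\ `|x - s| < d + n.+1%:R^-1.
  have n0 : 0 < n.+1%:R^-1 :> R by [].
  by have [_ [s Ss <-] xs] := inf_adherent n0 hD; exists s.
pose u n := projT1 (cid (ex n)).
have Su n : S (u n) by rewrite /u; case: cid => s [].
have xu n : `|x - u n| < d + n.+1%:R^-1 by rewrite /u; case: cid => s [].
(* Parallelogram law, with the midpoint of [s] and [t] in [S] and hence at distance at least [d]
   from [x]. *)
have par s t : S s -> S t ->
    `|s - t| ^+ 2 <= 2 * `|x - s| ^+ 2 + 2 * `|x - t| ^+ 2 - 4 * d ^+ 2.
  move=> Ss St.
  have : d ^+ 2 <= `|x - 2^-1 *: (s + t)| ^+ 2.
    rewrite ler_pXn2r ?nnegrE//; apply: dS.
    by apply: (subspaceZ Ssub); exact: (subspaceD Ssub).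
  rewrite !normB_dot !dotZr !dotZl !dotDr !dotDl (dotC t s).
  lra.
have cu : cvg (u @ \oo).
  apply/cauchy_cvgP/cauchy_exP => e e0.
  (* With both distances at most d + t, [par] gives 4 (d + t)^2 - 4 d^2 = 8 d t + 4 t^2, which is at
     most 4 (2 d + 1) t for t <= 1. *)
  have [k kP] : exists k : nat, 4 * (2 * d + 1) * k.+1%:R^-1 < e ^+ 2.
    have c0 : 0 < 4 * (2 * d + 1) by rewrite mulr_gt0// ltr_wpDl// mulr_ge0.
    have e2 : 0 < e ^+ 2 / (4 * (2 * d + 1)) by rewrite divr_gt0// exprn_gt0.
    have [k] := ltr_add_invr e2; rewrite add0r => ke.
    by exists k; rewrite mulrC -ltr_pdivlMr.
  exists (u k); change (\forall n \near \oo, ball (u k) e (u n)); near=> n.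
  have kn : (k <= n)%N by near: n; exact: nbhs_infty_ge.
  rewrite -ball_normE/= -(@ltr_pXn2r _ 2)// ?nnegrE ?(ltW e0)//.
  apply: le_lt_trans kP; apply: le_trans (par _ _ (Su k) (Su n)) _.
  have t0 : 0 < k.+1%:R^-1 :> R by [].
  have t1 : k.+1%:R^-1 <= 1 :> R by rewrite invf_le1// ler1n.
  have tn : n.+1%:R^-1 <= k.+1%:R^-1 :> R by rewrite lef_pV2 ?posrE// ler_nat.
  have xk : `|x - u k| ^+ 2 <= (d + k.+1%:R^-1) ^+ 2.
    by rewrite ler_pXn2r ?nnegrE ?addr_ge0// ltW.
  have xn : `|x - u n| ^+ 2 <= (d + k.+1%:R^-1) ^+ 2.
    rewrite ler_pXn2r ?nnegrE ?addr_ge0//; apply: le_trans (ltW (xu n)) _.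
    exact: lerD.
  move: t0 t1 xk xn; set t := k.+1%:R^-1; move=> t0 t1 xk xn.
  have : t * t <= t by rewrite ger_pMl.
  by rewrite !expr2 in xk xn *; lra.
pose p := lim (u @ \oo).
have Sp : S p by apply: closed_cvg cu => //; apply: nearW => n; exact: Su.
have xp : `|x - p| <= d.
  have xup : `|x - u n| @[n --> \oo] --> `|x - p|.
    by apply: cvg_norm; apply: cvgB => //; exact: cvg_cst.
  have dl : d + n.+1%:R^-1 @[n --> \oo] --> d.
    rewrite -[X in _ --> X]addr0; apply: cvgD; first exact: cvg_cst.
    exact: cvg_harmonic.
  by apply: (ler_cvg_to xup dl); near=> n; exact/ltW/xu.
exists p; split=> // s Ss.
apply/eqP/negPn/negP => xps.
have s0 : 0 < `|s| ^+ 2.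
  rewrite exprn_gt0// normr_gt0; apply: contra_neq xps => ->.
  by rewrite dot0r.
(* Moving [p] by the component of [x - p] along [s] would lower the minimal squared distance by <x -
   p, s>^2 / |s|^2. *)
pose c := dot (x - p) s / `|s| ^+ 2.
have : `|x - (p + c *: s)| ^+ 2 < `|x - p| ^+ 2.
  rewrite opprD addrA normB_dot dotZr dotZl dotZr dot_norm.
  rewrite (dot_norm s) /c.
  set a := dot _ _; set b := `|s| ^+ 2.
  have -> : `|x - p| ^+ 2 - 2 * (a / b * a) + a / b * (a / b * b) =
    `|x - p| ^+ 2 - a ^+ 2 / b by field; rewrite gt_eqF.
  by rewrite ltrBlDr ltrDl divr_gt0// lt_def sqr_ge0 sqrf_eq0 xps.
apply/negP; rewrite -leNgt ler_pXn2r ?nnegrE//.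
apply: le_trans xp _; apply: dS; apply: (subspaceD Ssub) => //.
exact: (subspaceZ Ssub).
Unshelve. all: by end_near. Qed.

End hilbert_space.

(** * Orthogonal projections, power functions and Galerkin solutions *)

Section projections.
Context {R : realType} {V : lmodType R} (D : set V) (q : V -> V -> R).
Hypothesis qD : psd_form D q.
Let sub := psd_sub qD.
Variables (N : nat) (e : 'I_N -> V).
Hypothesis De : forall j, D (e j).
Let S := lspan e.
Let SD : S `<=` D := lspan_sub sub De.
Let P := orth_proj q S.

Lemma orth_projP y : D y -> S (P y) /\ forall s, S s -> q (y - P y) s = 0.
Proof.
move=> Dy; apply: (@xgetPex _ 0 [set p | S p /\ forall s, S s -> q (y - p) s = 0]).
have [f [fe fP]] := psd_projection qD De.
exists (\sum_j q y (f j) *: f j); split; last by move=> s Ss; exact: fP.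
apply: (subspace_sum (subspace_lspan e)) => j.
exact: (subspaceZ (subspace_lspan e)).
Qed.

Hypothesis q_definite : forall s, S s -> q s s = 0 -> s = 0.

(** Two candidates differ by an element of [S] orthogonal to [S], hence of zero form; definiteness
    is asked for on [S] alone, since the L2 form is degenerate elsewhere. *)
Lemma orth_proj_eq y p : D y -> S p -> (forall s, S s -> q (y - p) s = 0) ->
  P y = p.
Proof.
move=> Dy Sp yp; have [SP PP] := orth_projP Dy.
have Spp : S (P y - p) by exact: (subspaceB (subspace_lspan e)).
apply: subr0_eq; apply: q_definite => //.
have {1}-> : P y - p = (y - p) - (y - P y).
  by rewrite [RHS]addrC opprB addrA subrK.
rewrite (psdBl qD)//; first by rewrite yp// PP// subrr.
- by apply: (subspaceB sub) => //; exact: SD.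
- by apply: (subspaceB sub) => //; exact: SD.
- exact: SD.
Qed.

(** Uniqueness identifies the chosen projection with the Gram-Schmidt sum, from which linearity and
    finite rank can be read off. *)
Lemma orth_proj_sum : exists f : 'I_N -> V, (forall j, S (f j)) /\
  forall y, D y -> P y = \sum_j q y (f j) *: f j.
Proof.
have [f [fe fP]] := psd_projection qD De.
exists f; split=> // y Dy; apply: orth_proj_eq => //; last first.
  by move=> s Ss; exact: fP.
apply: (subspace_sum (subspace_lspan e)) => j.
exact: (subspaceZ (subspace_lspan e)).
Qed.

Lemma orth_proj_linear a x y : D x -> D y -> P (a *: x + y) = a *: P x + P y.
Proof.
move=> Dx Dy; have [f [Sf Pf]] := orth_proj_sum.
rewrite !Pf//; last exact: sub.2.
rewrite scaler_sumr -big_split/=; apply: eq_bigr => j _.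
by rewrite (psd_linear qD)//; [rewrite scalerDl scalerA|exact/SD/Sf].
Qed.

Lemma orth_proj_id s : S s -> P s = s.
Proof.
move=> Ss; apply: orth_proj_eq => //; first exact: SD.
by move=> t St; rewrite subrr (psd0l qD)//; exact: SD.
Qed.

Lemma orth_projB_norm y : D y -> q (y - P y) (y - P y) = q y y - q (P y) y.
Proof.
move=> Dy; have [SP PP] := orth_projP Dy.
have DP : D (P y) by exact: SD.
have DyP : D (y - P y) by exact: (subspaceB sub).
by rewrite (psdBr qD)// (PP _ SP) subr0 (psdBl qD).
Qed.

Lemma le_orth_projB_norm y : D y -> q (y - P y) (y - P y) <= q y y.
Proof.
move=> Dy; rewrite orth_projB_norm//; have [SP PP] := orth_projP Dy.
have DP : D (P y) by exact: SD.
rewrite lerBlDr lerDl (psdC qD)// -[X in q X _](subrK (P y)).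
by rewrite (psdDl qD) ?PP ?add0r ?(psd_ge0 qD)//; exact: (subspaceB sub).
Qed.

Lemma le_orth_proj_norm y : D y -> q (P y) (P y) <= q y y.
Proof.
move=> Dy; have [SP PP] := orth_projP Dy.
have DP : D (P y) by exact: SD.
have DyP : D (y - P y) by exact: (subspaceB sub).
have -> : q y y = q (y - P y) (y - P y) + q (P y) (P y).
  rewrite orth_projB_norm// -[X in _ = _ - q _ X + _](subrK (P y)).
  by rewrite (psdDr qD)// (psdC qD DP DyP) PP// add0r subrK.
by rewrite lerDr (psd_ge0 qD).
Qed.

Section power.
Context {n : nat} (ev : V -> 'cV[R]_n -> R) (k : 'cV[R]_n -> 'cV[R]_n -> R).
Variables (x : 'cV[R]_n) (kx : V).
Hypothesis Dkx : D kx.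
Hypothesis kx_repr : forall h, D h -> q h kx = ev h x.
Hypothesis kxx : k x x = ev kx x.

(** For s in [S], <s, P kx> = <s, kx> = s(x), so the projected representer reproduces on [S]. *)
Lemma sub_ksec_orth_proj : sub_ksec q ev S x = P kx.
Proof.
have [SP PP] := orth_projP Dkx.
have DP : D (P kx) by exact: SD.
apply: xget_unique => /=.
  split=> // s Ss; have Ds := SD Ss; rewrite -kx_repr//.
  have : q (kx - P kx) s = 0 by exact: PP.
  by rewrite (psdBl qD)// (psdC qD Ds DP) (psdC qD Ds Dkx) => /subr0_eq.
move=> y [Sy yP]; apply/esym; apply: orth_proj_eq => // s Ss.
have Dy := SD Sy; have Ds := SD Ss.
by rewrite (psdBl qD)// (psdC qD Dkx Ds) kx_repr// (psdC qD Dy Ds) yP// subrr.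
Qed.

(** The power function is thus the distance from the representer of evaluation at [x] to [S]. *)
Lemma power_functionE :
  power_function q ev k S x = Num.sqrt (q (kx - P kx) (kx - P kx)).
Proof.
rewrite /power_function sub_ksec_orth_proj orth_projB_norm// kxx -!kx_repr//.
by have [SP _] := orth_projP Dkx; exact: SD.
Qed.

Lemma power_function_le : power_function q ev k S x <= Num.sqrt (k x x).
Proof.
by rewrite power_functionE kxx -kx_repr// ler_wsqrtr// le_orth_projB_norm.
Qed.

(** Orthogonality allows [P kx] to be subtracted from the representer at no cost; Cauchy-Schwarz
    then applies to [h] and [kx - P kx]. *)
Lemma le_power_function h : D h -> (forall s, S s -> q h s = 0) ->
  `|ev h x| <= Num.sqrt (q h h) * power_function q ev k S x.
Proof.
move=> Dh hS; have [SP PP] := orth_projP Dkx.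
have DP : D (P kx) by exact: SD.
have Dkp : D (kx - P kx) by exact: (subspaceB sub).
have -> : ev h x = q h (kx - P kx).
  by rewrite (psdBr qD)// (hS _ SP) subr0 kx_repr.
rewrite power_functionE -sqrtrM; last exact: (psd_ge0 qD).
by rewrite -sqrtr_sqr ler_wsqrtr// (psd_cauchy_schwarz qD).
Qed.

End power.

Section galerkin.
Context {H : normedModType R} (A : H -> V) (HS : set H).
Hypothesis A_linear : forall a x y, A (a *: x + y) = a *: A x + A y.
Hypothesis A_data : forall h, D (A h).
Hypothesis HS_sub : linear_subspace HS.
Hypothesis bij : set_bij HS S (P \o A).
Let G := galerkin A HS P.

Lemma galerkin_eq h y : D y -> HS h -> P (A h) = P y -> G y = h.
Proof.
move=> Dy HSh PhPy; rewrite /G /galerkin -PhPy.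
have [_ inj _] := bij.
by rewrite -[P (A h)]/((P \o A) h) pinvKV// inE.
Qed.

Lemma galerkinK h : HS h -> G (A h) = h.
Proof. by move=> HSh; apply: galerkin_eq. Qed.

Lemma galerkin_sum : exists (f : 'I_N -> V) (h : 'I_N -> H),
  (forall j, D (f j)) /\ forall y, D y -> G y = \sum_j q y (f j) *: h j.
Proof.
have [f [Sf Pf]] := orth_proj_sum.
have [_ _ surj] := bij.
pose h j := projT1 (cid2 (surj _ (Sf j))).
have hS j : HS (h j) by rewrite /h; case: cid2.
have Ph j : P (A (h j)) = f j by rewrite /h; case: cid2.
exists f, h; split=> [j|y Dy]; first exact/SD/Sf.
apply: galerkin_eq => //.
  by apply: (subspace_sum HS_sub) => j; exact: (subspaceZ HS_sub).
rewrite (Pf y)//; elim/big_rec2 : _ => [|j s t _ <-].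
  have := A_linear 1 0 0; rewrite scaler0 addr0 scale1r => A0.
  have {A0}-> : A 0 = 0 by apply: (@addrI _ (A 0)); rewrite -A0 addr0.
  by apply: orth_proj_id; exact: (subspace_lspan e).1.
by rewrite A_linear orth_proj_linear// Ph.
Qed.

Lemma galerkin_linear a y z : D y -> D z -> G (a *: y + z) = a *: G y + G z.
Proof.
move=> Dy Dz; have [f [h [Df Gf]]] := galerkin_sum.
rewrite !Gf//; last exact: sub.2.
rewrite scaler_sumr -big_split/=; apply: eq_bigr => j _.
by rewrite (psd_linear qD)// scalerDl scalerA.
Qed.

Lemma galerkin_bounded : exists2 C, 0 <= C &
  forall y, D y -> `|G y| <= C * Num.sqrt (q y y).
Proof.
have [f [h [Df Gf]]] := galerkin_sum.
exists (\sum_j Num.sqrt (q (f j) (f j)) * `|h j|).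
  by apply: sumr_ge0 => j _; rewrite mulr_ge0// sqrtr_ge0.
move=> y Dy; rewrite Gf// mulr_suml (le_trans (ler_norm_sum _ _ _))//.
apply: ler_sum => j _; rewrite normrZ mulrAC ler_wpM2r//.
rewrite mulrC -sqrtrM; last exact: (psd_ge0 qD).
by rewrite -sqrtr_sqr ler_wsqrtr// (psd_cauchy_schwarz qD).
Qed.

End galerkin.

End projections.

(** * Pairing operators and the quotient inner product on their range *)

Section pairing_operators.
Context {R : realType} {H : completeNormedModType R} (dot : {dot H for idfun}).
Hypothesis dot_norm : forall h, dot h h = `|h| ^+ 2.
Context {T : Type} (Omega : set T) (al : T -> H).

Definition pairing_op (h : H) : T -> R := (fun x => dot h (al x)) \_ Omega.

Local Notation A := pairing_op.
Local Notation NA := (nullspace A).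
Local Notation perp := (orthocomplement dot NA).

Lemma pairing_opE h x : Omega x -> A h x = dot h (al x).
Proof. by move=> Ox; rewrite /pairing_op patchE mem_set. Qed.

Lemma pairing_op_linear a h h' : A (a *: h + h') = a *: A h + A h'.
Proof.
apply/funext => x; change (A (a *: h + h') x = a * A h x + A h' x).
rewrite /pairing_op !patchE; case: ifPn => _; last by rewrite mulr0 addr0.
by rewrite (dotDl dot_norm) (dotZl dot_norm).
Qed.

Lemma pairing_opB h h' : A (h - h') = A h - A h'.
Proof. by rewrite addrC -scaleN1r pairing_op_linear scaleN1r addrC. Qed.

Lemma nullspace_pairing h : NA h <-> forall x, Omega x -> dot h (al x) = 0.
Proof.
split=> [Ah x Ox|hx]; first by rewrite -pairing_opE// Ah.
apply/funext => x; rewrite /pairing_op patchE; case: ifPn => //.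
by move=> /set_mem; exact: hx.
Qed.

Lemma nullspace_pairing_sub : linear_subspace NA.
Proof.
split; first by apply/nullspace_pairing => x _; rewrite (dot0l dot_norm).
move=> a x y Nx Ny; rewrite /nullspace /= pairing_op_linear.
by rewrite (Nx : A x = 0) (Ny : A y = 0) scaler0 addr0.
Qed.

Lemma continuous_dotl y : continuous (dot^~ y).
Proof.
move=> x; apply: (dot_cvg dot_norm (f := id) (g := fun=> y)) => //.
exact: cvg_cst.
Qed.

Lemma nullspace_pairing_closed : closed NA.
Proof.
have -> : NA = \bigcap_(x in Omega) (dot^~ (al x) @^-1` [set 0]).
  apply/seteqP; split=> h; first by move/nullspace_pairing.
  by move=> hx; apply/nullspace_pairing => x Ox; exact: hx.
apply: closed_bigI => x _; apply: closed_comp; last exact: closed_eq.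
by move=> h _; exact: continuous_dotl.
Qed.

(** Subtract the projection onto the closed null space. The result is the representative that
    attains the infimum in the quotient norm. *)
Lemma pairing_op_perp h : exists r, perp r /\ A r = A h.
Proof.
have [p [Np pP]] :=
  closed_projection dot_norm nullspace_pairing_sub nullspace_pairing_closed h.
by exists (h - p); split; [exact: pP|rewrite pairing_opB (Np : A p = 0) subr0].
Qed.

Lemma dot_perp r h h' : perp r -> A h = A h' -> dot r h = dot r h'.
Proof.
move=> rP hh'; apply/subr0_eq; rewrite -(dotBr dot_norm); apply: rP.
by rewrite /nullspace /= pairing_opB hh' subrr.
Qed.

Lemma perp_norm_le r h : perp r -> A r = A h -> `|r| <= `|h|.
Proof.
move=> rP rh; have [->|r0] := eqVneq r 0; first by rewrite normr0.
rewrite -(@ler_pM2l _ `|r|) ?normr_gt0//.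
rewrite -expr2 -dot_norm (dot_perp rP rh).
exact: le_trans (ler_norm _) (le_dot_norm dot_norm _ _).
Qed.

Lemma qnorm_perp r : perp r -> qnorm A (A r) = `|r|.
Proof.
move=> rP; apply/eqP; rewrite eq_le; apply/andP; split.
  by apply: ge_inf; [exists 0 => _ [h _ <-]|exists r].
apply: lb_le_inf; first by exists `|r|, r.
by move=> _ [h Ah <-]; apply: perp_norm_le.
Qed.

Lemma qnorm_pairing_le h : qnorm A (A h) <= `|h|.
Proof.
have [r [rP rh]] := pairing_op_perp h.
by rewrite -rh qnorm_perp// perp_norm_le.
Qed.

Lemma perp_sub : linear_subspace perp.
Proof.
split=> [s _|a x y Px Py s Ns]; first exact: (dot0l dot_norm).
by rewrite (dotDl dot_norm) (dotZl dot_norm) Px// Py// mulr0 addr0.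
Qed.

(** On orthogonal representatives the quotient norm is the norm of [H], so polarization returns
    [dot]. Afterwards [h] may be any representative, because [r] is orthogonal to the difference of
    two of them. *)
Lemma qdot_perp r h : perp r -> qdot A (A r) (A h) = dot r h.
Proof.
move=> rP; have [h' [h'P h'h]] := pairing_op_perp h.
rewrite -(dot_perp rP h'h) -h'h /qdot -pairing_opB.
have -> : A r + A h' = A (r + h').
  by have := pairing_op_linear 1 r h'; rewrite !scale1r.
rewrite !qnorm_perp; last 2 first.
- exact: (subspaceB perp_sub).
- exact: (subspaceD perp_sub).
rewrite -!dot_norm !(dotBl dot_norm, dotBr dot_norm, dotDl dot_norm, dotDr dot_norm).
by rewrite (dotC dot_norm h' r); field.
Qed.

Lemma range_pairing_sub : linear_subspace (range A).
Proof.
split; first by exists 0 => //; exact: nullspace_pairing_sub.1.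
by move=> a _ _ [h _ <-] [h' _ <-]; exists (a *: h + h') => //; rewrite pairing_op_linear.
Qed.

Lemma qdot_psd : psd_form (range A) (qdot A).
Proof.
split; first exact: range_pairing_sub.
- move=> _ _ [h _ <-] [h' _ <-].
  have [r [rP <-]] := pairing_op_perp h; have [r' [rP' <-]] := pairing_op_perp h'.
  by rewrite !qdot_perp// (dotC dot_norm).
- move=> a _ _ _ [h _ <-] [h' _ <-] [h'' _ <-].
  have [r [rP <-]] := pairing_op_perp h; have [r' [rP' <-]] := pairing_op_perp h'.
  rewrite -pairing_op_linear !qdot_perp//; last exact: perp_sub.2.
  by rewrite (dotDl dot_norm) (dotZl dot_norm).
- move=> _ [h _ <-]; have [r [rP <-]] := pairing_op_perp h.
  by rewrite qdot_perp// dot_norm sqr_ge0.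
Qed.

Lemma qdot_qnorm h : qdot A (A h) (A h) = qnorm A (A h) ^+ 2.
Proof.
by have [r [rP <-]] := pairing_op_perp h; rewrite qdot_perp// qnorm_perp// dot_norm.
Qed.

Lemma sqrt_qdot h : Num.sqrt (qdot A (A h) (A h)) = qnorm A (A h).
Proof.
rewrite qdot_qnorm sqrtr_sqr ger0_norm//.
by have [r [rP <-]] := pairing_op_perp h; rewrite qnorm_perp.
Qed.

Lemma qdot_definite w : range A w -> qdot A w w = 0 -> w = 0.
Proof.
move=> [h _ <-]; have [r [rP <-]] := pairing_op_perp h.
by rewrite qdot_perp// => /(dot_eq0 dot_norm) ->; exact: nullspace_pairing_sub.1.
Qed.

Lemma pairing_vector_perp x : Omega x -> perp (al x).
Proof. by move=> Ox h /nullspace_pairing /(_ x Ox); rewrite (dotC dot_norm). Qed.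

(** [al x] is orthogonal to the null space by its very definition, so it is the minimal
    representative of the kernel section, and <A h, A (al x)> = <h, al x> = (A h)(x). *)
Lemma qdot_repr x w : Omega x -> range A w -> qdot A w (A (al x)) = w x.
Proof.
move=> Ox Aw; rewrite (psdC qdot_psd)//; case: Aw => h _ <-.
rewrite qdot_perp; last exact: pairing_vector_perp.
by rewrite pairing_opE// (dotC dot_norm).
Qed.

End pairing_operators.

(** * Derivatives of the kernel *)

Section directional_derivatives.
Context {R : realType} {V : normedModType R}.

(** Density of the interior makes the filter in [dext] proper, hence its limit unique, also at
    boundary points. *)
Lemma dext_eq (D : set V) (e : V) (f df : V -> R) :
  D `<=` closure D° -> (forall x, D° x -> is_derive x e f (df x)) ->
  {within D, continuous df} -> forall x, D x -> dext D e f x = df x.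
Proof.
move=> Dcl fdf /subspace_continuousP cdf x Dx.
have PF : ProperFilter (within D° (nbhs x)) by exact/within_nbhs_proper/Dcl.
apply: (@cvg_lim _ _ _ _ PF _ (df x)) => //.
have dfx : df y @[y --> within D° (nbhs x)] --> df x.
  apply: cvg_trans (cdf x Dx); apply: cvg_app.
  by apply: within_subset; exact: interior_subset.
apply: cvg_trans dfx; apply: near_eq_cvg.
by rewrite near_withinE; near=> y => /fdf [_ ->].
Unshelve. all: by end_near. Qed.

Lemma is_derive_line (f : V -> R) (x e : V) (t df : R) :
  is_derive (x + t *: e) e f df -> is_derive t (1 : R) (fun s => f (x + s *: e)) df.
Proof.
have E : (fun h => h^-1 *: ((f \o shift (x + t *: e)) (h *: e) - f (x + t *: e))) =
  (fun h : R => h^-1 *: (((fun s => f (x + s *: e)) \o shift t) (h *: (1 : R)) -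
     f (x + t *: e))).
  apply/funext => h /=; congr (_ *: (f _ - _)).
  by rewrite [h *: 1]mulr1 scalerDl addrCA.
by case; rewrite /derivable /derive E => ? ?; split.
Qed.

Lemma mean_value (g dg : R -> R) (r t : R) :
  (forall s, `|s| <= r -> is_derive s (1 : R) g (dg s)) -> `|t| <= r ->
  exists2 s, `|s| <= `|t| & g t - g 0 = dg s * t.
Proof.
move=> gdg tr.
have cg a b : -r <= a -> b <= r -> {within `[a, b], continuous g}.
  move=> ra br; apply: derivable_within_continuous => s /[!in_itv]/= /andP[as_ sb].
  by have [] : is_derive s (1 : R) g (dg s) by apply: gdg; rewrite ler_norml; lra.
have dgI a b : -r <= a -> b <= r ->
    forall s, s \in `]a, b[%R -> is_derive s (1 : R) g (dg s).
  by move=> ra br s /[!in_itv]/= /andP[as_ sb]; apply: gdg; rewrite ler_norml; lra.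
have [t0|t0] := lerP 0 t.
  move: tr; rewrite ger0_norm// => tr.
  have r0 : - r <= 0 by lra.
  have [s] := MVT_segment t0 (dgI _ _ r0 tr) (cg _ _ r0 tr).
  rewrite in_itv/= => /andP[s0 st] ->; exists s; last by rewrite subr0.
  by rewrite ger0_norm.
move: tr; rewrite ltr0_norm// => tr.
have r0 : 0 <= r by lra.
have rt : - r <= t by lra.
have [s] := MVT_segment (ltW t0) (dgI _ _ rt r0) (cg _ _ rt r0).
rewrite in_itv/= => /andP[s0 st] E; exists s; first by rewrite ler0_norm//; lra.
by move: E; rewrite sub0r mulrN => E; lra.
Qed.

Lemma line_nbhs (x e : V) (P : set V) : nbhs x P ->
  exists2 r, 0 < r & forall s : R, `|s| <= r -> P (x + s *: e).
Proof.
move=> xP; have /(_ P) : (fun s : R => x + s *: e) @ (0 : R) --> x + 0 *: e.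
  by apply: cvgD; [exact: cvg_cst|apply: cvgZr_tmp; exact: cvg_id].
rewrite scale0r addr0 => /(_ xP)/nbhs_ballP[r /= r0 rP].
exists (r / 2); first by rewrite divr_gt0.
move=> s sr; apply: rP; rewrite -ball_normE/= sub0r normrN.
by rewrite (le_lt_trans sr)// gtr_pMr// invf_lt1// ltr1n.
Qed.

End directional_derivatives.

(** * Representers of partial derivatives, up to the boundary *)

Section derivative_reproducing.
Context {R : realType} {n : nat}.
Notation T := 'cV[R]_n.
Variables (Omega : set T) (K : T -> T -> R).
Hypothesis Omega_closure : Omega = closure Omega°.
Hypothesis K_sym : forall x y, Omega x -> Omega y -> K x y = K y x.
Context {H : completeNormedModType R} (dot : {dot H for idfun}) (ev : H -> T -> R).
Hypothesis H_rkhs : is_rkhs Omega K dot ev.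
Let dot_norm := rkhs_norm H_rkhs.
Let D := Omega `*` Omega.

Definition kernel_vec (y : T) : H :=
  xget 0 [set Ky | ev Ky = ksec Omega K y /\ forall h, dot h Ky = ev h y].

Lemma kernel_vecP y : Omega y ->
  ev (kernel_vec y) = ksec Omega K y /\ forall h, dot h (kernel_vec y) = ev h y.
Proof.
move=> Oy; have [Ky ? ?] := rkhs_repr H_rkhs Oy.
exact: (@xgetI _ 0 [set Ky | ev Ky = ksec Omega K y /\ forall h, dot h Ky = ev h y] Ky).
Qed.

Lemma dot_kernel_vec x y : Omega x -> Omega y ->
  dot (kernel_vec x) (kernel_vec y) = K x y.
Proof.
move=> Ox Oy; rewrite (kernel_vecP Oy).2 (kernel_vecP Ox).1 /ksec patchE mem_set//.
exact: K_sym.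
Qed.

Let D_interior x y : Omega° x -> Omega° y -> D° (x, y).
Proof. by move=> Ox Oy; exists (Omega, Omega). Qed.

Let D_closure : D `<=` closure D°.
Proof.
move=> [x y] [/= Ox Oy] B [[P Q] /= [xP yQ] PQ].
rewrite Omega_closure in Ox; rewrite Omega_closure in Oy.
have [x' [Ox' Px']] := Ox _ xP; have [y' [Oy' Qy']] := Oy _ yQ.
by exists (x', y'); split; [exact: D_interior|exact: PQ].
Qed.

Let Omega_proper x : Omega x -> ProperFilter (within Omega° (nbhs x)).
Proof. by rewrite {1}Omega_closure => Ox; exact/within_nbhs_proper. Qed.

Variables (K1 : 'I_n -> T * T -> R) (K2 : 'I_n -> 'I_n -> T * T -> R).
Hypothesis K1P : forall j z, D° z ->
  is_derive z (unit_vec2 (inr j)) (fun z => K z.1 z.2) (K1 j z).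
Hypothesis K1_cont : forall j, {within D, continuous (K1 j)}.
Hypothesis K2P : forall i j z, D° z ->
  is_derive z (unit_vec2 (inl i)) (K1 j) (K2 i j z).
Hypothesis K2_cont : forall i j, {within D, continuous (K2 i j)}.

Lemma partial2E i j x y : Omega x -> Omega y ->
  partial2 Omega K i j x y = K2 i j (x, y).
Proof.
move=> Ox Oy; apply: dext_eq => // z Dz.
apply: near_eq_is_derive (K2P i j Dz).
have nz : nbhs z D° by apply: open_nbhs_nbhs; split=> //; exact: open_interior.
near=> w; apply/esym.
apply: dext_eq; [exact: D_closure|exact: K1_cont|].
by apply: interior_subset; near: w; exact: nz.
Unshelve. all: by end_near. Qed.

Definition difference_vec (i : 'I_n) (y : T) (t : R) : H :=
  t^-1 *: (kernel_vec (y + t *: unit_vec i) - kernel_vec y).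

(* The second difference quotient is a value of the mixed derivative, by the
   mean value theorem in each variable. *)
Lemma dot_difference_vec i j x y : Omega° x -> Omega° y ->
  exists2 r, 0 < r & forall t s, `|t| <= r -> `|s| <= r -> t != 0 -> s != 0 ->
    exists t' s', [/\ `|t'| <= `|t|, `|s'| <= `|s| &
      dot (difference_vec i x t) (difference_vec j y s) =
        K2 i j (x + t' *: unit_vec i, y + s' *: unit_vec j)].
Proof.
move=> Ox Oy.
have nx : nbhs x Omega° by apply: open_nbhs_nbhs; split => //; exact: open_interior.
have ny : nbhs y Omega° by apply: open_nbhs_nbhs; split => //; exact: open_interior.
have [r1 r10 r1P] := line_nbhs (unit_vec i) nx.
have [r2 r20 r2P] := line_nbhs (unit_vec j) ny.
exists (Num.min r1 r2); first by rewrite lt_min r10.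
move=> t s; rewrite !le_min => /andP[tr1 _] /andP[_ sr2] t0 s0.
set ei := unit_vec i; set ej := unit_vec j.
have Oxt := r1P _ tr1; have Oys := r2P _ sr2.
have pairE (z : T) (u : R) : (z, y + u *: ej) = (z, y) + u *: unit_vec2 (inr j).
  by congr pair; rewrite /= ?scaler0 ?addr0.
have pairE' (z : T) (u : R) : (x + u *: ei, z) = (x, z) + u *: unit_vec2 (inl i).
  by congr pair; rewrite /= ?scaler0 ?addr0.
(* The second variable is treated first because [K2] differentiates [K1], which is already a
   derivative in the second slot. The point [s'] found for [g] is then frozen while the mean value
   theorem is applied in the first variable. *)
pose g u := K (x + t *: ei) (y + u *: ej) - K x (y + u *: ej).
pose dg u := K1 j (x + t *: ei, y + u *: ej) - K1 j (x, y + u *: ej).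
have gdg u : `|u| <= r2 -> is_derive u (1 : R) g (dg u).
  move=> ur.
  have -> : g = (fun u => K (x + t *: ei) (y + u *: ej)) -
                (fun u => K x (y + u *: ej)) by [].
  have dK (z : T) : Omega° z ->
      is_derive u (1 : R) (fun u => K z (y + u *: ej)) (K1 j (z, y + u *: ej)).
    move=> Oz.
    have -> : (fun u => K z (y + u *: ej)) =
        (fun u => (fun z => K z.1 z.2) ((z, y) + u *: unit_vec2 (inr j))).
      by apply/funext => w; rewrite -pairE.
    move: (K1P j (D_interior Oz (r2P _ ur))); rewrite -/ej pairE => D1.
    exact: is_derive_line D1.
  exact: (is_deriveB (dK _ Oxt) (dK _ Ox)).
have [s' s's gs] := mean_value gdg sr2.
have Oys' := r2P _ (le_trans s's sr2).
pose k u := K1 j (x + u *: ei, y + s' *: ej).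
pose dk u := K2 i j (x + u *: ei, y + s' *: ej).
have kdk u : `|u| <= r1 -> is_derive u (1 : R) k (dk u).
  move=> ur.
  have -> : k = (fun u => K1 j ((x, y + s' *: ej) + u *: unit_vec2 (inl i))).
    by apply/funext => w; rewrite -pairE'.
  move: (K2P i j (D_interior (r1P _ ur) Oys')); rewrite /dk -/ei -/ej pairE' => D2.
  exact: is_derive_line D2.
have [t' t't kt] := mean_value kdk tr1.
exists t', s'; split=> //.
have Ix := @interior_subset _ Omega.
rewrite /difference_vec (dotZl dot_norm) (dotZr dot_norm) (dotBl dot_norm).
rewrite !(dotBr dot_norm) (dot_kernel_vec (Ix _ Oxt) (Ix _ Oys)).
rewrite (dot_kernel_vec (Ix _ Oxt) (Ix _ Oy)) (dot_kernel_vec (Ix _ Ox) (Ix _ Oys)).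
rewrite (dot_kernel_vec (Ix _ Ox) (Ix _ Oy)).
have -> : K (x + t *: ei) (y + s *: ej) - K (x + t *: ei) y -
    (K x (y + s *: ej) - K x y) = g s - g 0.
  by rewrite /g scale0r addr0; ring.
have -> : g s - g 0 = dk t' * t * s.
  by rewrite gs -kt /dg /k scale0r addr0.
by rewrite -/(dk t'); field; rewrite t0 s0.
Qed.

(** The two steps tend to 0 independently, as [gram_cvg] requires. The intermediate points are no
    farther than the steps, so continuity of [K2] at (x, y) gives the limit. *)
Lemma difference_vec_gram i j x y : Omega° x -> Omega° y ->
  (fun p => dot (difference_vec i x p.1) (difference_vec j y p.2)) @
    filter_prod 0^' 0^' --> K2 i j (x, y).
Proof.
move=> Ox Oy; have [r r0 rP] := dot_difference_vec i j Ox Oy.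
have Dxy := D_interior Ox Oy.
have nD : nbhs (x, y) D by exact: Dxy.
have cK : K2 i j @ nbhs (x, y) --> K2 i j (x, y).
  have /subspace_continuousP/(_ (x, y) (interior_subset Dxy)) := K2_cont (i := i) (j := j).
  by rewrite (within_interior Dxy).
apply/cvgrPdist_lt => e e0.
move/cvgrPdist_lt : cK => /(_ e e0) [[P Q] /= [xP yQ] PQ].
have [r1 r10 r1P] := line_nbhs (unit_vec i) xP.
have [r2 r20 r2P] := line_nbhs (unit_vec j) yQ.
pose S (r' : R) := [set t : R | t != 0 /\ `|t| <= Num.min r r'].
have SN r' : 0 < r' -> (0 : R)^' (S r').
  move=> r'0; near=> t; split; first by near: t; exact: nbhs_dnbhs_neq.
  by near: t; apply: dnbhs0_le; rewrite lt_min r0.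
exists (S r1, S r2); first by split; exact: SN.
move=> [t s] [/= [t0]]; rewrite le_min => /andP[tr tr1] [s0].
rewrite le_min => /andP[sr sr2].
have [t' [s' [t't s's ->]]] := rP _ _ tr sr t0 s0.
apply: (PQ (_, _)); split; [apply: r1P|apply: r2P].
  exact: le_trans tr1.
exact: le_trans sr2.
Unshelve. all: by end_near. Qed.

Let difference_vec_cvg i x : Omega° x -> cvg (difference_vec i x @ 0^').
Proof. by move=> Ox; apply: (gram_cvg dot_norm); exact: difference_vec_gram. Qed.

Let interior_vec i x := lim (difference_vec i x @ 0^').

Let dot_interior_vec i j x y : Omega° x -> Omega° y ->
  dot (interior_vec i x) (interior_vec j y) = K2 i j (x, y).
Proof.
move=> Ox Oy; apply: cvg_unique (difference_vec_gram (i := i) (j := j) Ox Oy) => //.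
apply: (dot_cvg_prod dot_norm); exact: difference_vec_cvg.
Qed.

Let interior_vec_gram i j x y : Omega x -> Omega y ->
  (fun p => dot (interior_vec i p.1) (interior_vec j p.2)) @
    filter_prod (within Omega° (nbhs x)) (within Omega° (nbhs y)) --> K2 i j (x, y).
Proof.
move=> Ox Oy.
have /subspace_continuousP/(_ (x, y) (conj Ox Oy)) cK := K2_cont (i := i) (j := j).
apply/cvgrPdist_lt => e e0.
move/cvgrPdist_lt : cK => /(_ e e0) [[P Q] /= [xP yQ] PQ].
exists (P `&` Omega°, Q `&` Omega°).
  by split; rewrite /within /=; near=> z => Oz; split=> //; near: z.
move=> [z w] /= [[Pz Oz] [Qw Ow]]; rewrite dot_interior_vec//.
by apply: (PQ (z, w)) => //; split; exact: interior_subset.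
Unshelve. all: by end_near. Qed.

(** Difference quotients may leave Omega at a boundary point, hence this second limit from the
    interior. It exists because the Gram values of the interior vectors are those of [K2], which is
    continuous on the closed product. *)
Definition derivative_vec (i : 'I_n) (x : T) : H :=
  lim (interior_vec i @ within Omega° (nbhs x)).

Let interior_vec_cvg i x : Omega x ->
  interior_vec i @ within Omega° (nbhs x) --> derivative_vec i x.
Proof.
move=> Ox; have PF := Omega_proper Ox.
by apply: (gram_cvg dot_norm); exact: interior_vec_gram.
Qed.

Lemma dot_derivative_vec i j x y : Omega x -> Omega y ->
  dot (derivative_vec i x) (derivative_vec j y) = partial2 Omega K i j x y.
Proof.
move=> Ox Oy; rewrite partial2E//.
have PFx := Omega_proper Ox; have PFy := Omega_proper Oy.
apply: cvg_unique (interior_vec_gram (i := i) (j := j) Ox Oy) => //.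
apply: (dot_cvg_prod dot_norm); exact: interior_vec_cvg.
Qed.

(** [partial] is itself a limit of interior derivatives, so the pairing with [h] is carried through
    the same two limits that define the vector. *)
Lemma partial_dot i x h : Omega x ->
  partial Omega i (ev h) x = dot h (derivative_vec i x).
Proof.
move=> Ox; have PF := Omega_proper Ox.
have Dh y : Omega° y -> 'D_(unit_vec i) (ev h) y = dot h (interior_vec i y).
  move=> Oy; apply: cvg_lim => //.
  have qh : dot h (difference_vec i y t) @[t --> 0^'] --> dot h (interior_vec i y).
    apply: (dot_cvg dot_norm (f := fun=> h)); first exact: cvg_cst.
    exact: difference_vec_cvg.
  apply: cvg_trans qh; apply: near_eq_cvg.
  have ny : nbhs y Omega° by apply: open_nbhs_nbhs; split => //; exact: open_interior.
  have [r r0 rP] := line_nbhs (unit_vec i) ny.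
  near=> t.
  have tr : `|t| <= r by near: t; exact: dnbhs0_le.
  rewrite /difference_vec (dotZr dot_norm) (dotBr dot_norm).
  rewrite (kernel_vecP (interior_subset Oy)).2.
  rewrite (kernel_vecP (interior_subset (rP _ tr))).2.
  by rewrite /= [y + _]addrC.
apply: cvg_lim => //.
have ih : dot h (interior_vec i y) @[y --> within Omega° (nbhs x)] -->
    dot h (derivative_vec i x).
  apply: (dot_cvg dot_norm (f := fun=> h)); first exact: cvg_cst.
  exact: interior_vec_cvg.
apply: cvg_trans ih; apply: near_eq_cvg.
by rewrite near_withinE; near=> y => Oy; rewrite Dh.
Unshelve. all: by end_near. Qed.

End derivative_reproducing.

Lemma Ck_on_mixed (R : realType) (n s : nat) (D : set ('cV[R]_n * 'cV[R]_n))
    (F : 'cV[R]_n * 'cV[R]_n -> R) : (1 <= s)%N ->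
  Ck_on (@unit_vec2 R n) D (2 * s) F ->
  exists (K1 : 'I_n -> 'cV[R]_n * 'cV[R]_n -> R)
         (K2 : 'I_n -> 'I_n -> 'cV[R]_n * 'cV[R]_n -> R),
  [/\ forall j z, D° z -> is_derive z (unit_vec2 (inr j)) F (K1 j z),
      forall j, {within D, continuous (K1 j)},
      forall i j z, D° z -> is_derive z (unit_vec2 (inl i)) (K1 j) (K2 i j z) &
      forall i j, {within D, continuous (K2 i j)}].
Proof.
(* The order is now [s.*2.+2]: two derivatives can be taken, and the second is still continuous when
   [s.*2] is 0. *)
case: s => // s _; rewrite mul2n doubleS => -[_ F1].
pose K1 j := projT1 (cid2 (F1 (inr j))).
have K1P j : (forall z, D° z -> is_derive z (unit_vec2 (inr j)) F (K1 j z)) /\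
    Ck_on (@unit_vec2 R n) D s.*2.+1 (K1 j).
  by rewrite /K1; case: cid2.
have F2 i j := (K1P j).2.2 (inl i).
pose K2 i j := projT1 (cid2 (F2 i j)).
have K2P i j : (forall z, D° z -> is_derive z (unit_vec2 (inl i)) (K1 j) (K2 i j z)) /\
    Ck_on (@unit_vec2 R n) D s.*2 (K2 i j).
  by rewrite /K2; case: cid2.
exists K1, K2; split.
- by move=> j z; apply: (K1P j).1.
- by move=> j; exact: (K1P j).2.1.
- by move=> i j z; apply: (K2P i j).1.
- by move=> i j; case: (s.*2) (K2P i j) => [|k] [_ []].
Qed.

(** * Lebesgue measure on column vectors *)

Section borel_sets.
Context {R : realType} {n : nat}.
Notation T := 'cV[R]_n.

Definition box (q : T) (e : R) : set T := [set x | forall i, `|q i 0 - x i 0| < e].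

Lemma measurable_box q e : measurable (box q e).
Proof.
have -> : box q e = \bigcap_(i in [set: 'I_n]) [set x : T | ball (q i 0) e (x i 0)].
  by apply/seteqP; split=> x xq i => [_|]; exact: xq.
apply: fin_bigcap_measurable => [|i _]; first exact: finite_finset.
rewrite -[X in measurable X]setTI.
by apply: (measurable_mx_coord i 0) => //; exact: measurable_ball.
Qed.

(** The sigma-algebra is generated by coordinates, so [U] is written as a countable union of
    rational boxes; a box not contained in [U] contributes the empty set. A half-width below e / 2
    keeps a box that contains [x] within distance e of it. *)
Lemma open_cV_measurable (U : set T) : open U -> measurable U.
Proof.
move=> oU.
pose B (z : 'cV[rat]_n * nat) := box (map_mx ratr z.1) z.2.+1%:R^-1.
pose F z := if `[< B z `<=` U >] then B z else set0.
have -> : U = \bigcup_z F z.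
  apply/seteqP; split=> [x Ux|x [z _]]; last first.
    by rewrite /F; case: asboolP => // zU /zU.
  have /nbhs_ballP[e /= e0 eU] : nbhs x U by exact: open_nbhs_nbhs.
  have e2 : 0 < e / 2 by rewrite divr_gt0.
  have [k] := ltr_add_invr e2; rewrite add0r => ke.
  have k0 : 0 < k.+1%:R^-1 :> R by [].
  have qP i : exists q : rat, ratr q \in `](x i 0 - k.+1%:R^-1), (x i 0 + k.+1%:R^-1)[%R.
    by apply: rat_in_itvoo; rewrite ltrBlDr -addrA ltrDl addr_gt0.
  pose q : 'cV[rat]_n := \col_i projT1 (cid (qP i)).
  have qx i : `|ratr (q i 0) - x i 0| < k.+1%:R^-1.
    by rewrite mxE; case: cid => /= r; rewrite in_itv/= ltr_distl.
  have qB : B (q, k) x by move=> i /=; rewrite mxE.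
  exists (q, k) => //; rewrite /F; case: asboolP => // -[] y yB.
  apply: eU; split=> // i j; rewrite (ord1 j).
  have := yB i; rewrite /= mxE => qy; rewrite /ball/= in qy *.
  rewrite -[X in X < _](_ : `|(x i 0 - ratr (q i 0)) + (ratr (q i 0) - y i 0)| = _); last first.
    by rewrite addrA subrK.
  rewrite (le_lt_trans (ler_normD _ _))// distrC [ltRHS]splitr.
  by rewrite ltrD// (lt_trans _ ke).
apply: countable_bigcupT_measurable; first exact: countableP.
move=> z; rewrite /F; case: asboolP => // _; exact: measurable_box.
Qed.

Lemma closed_cV_measurable (A : set T) : closed A -> measurable A.
Proof. by move/closed_openC/open_cV_measurable/measurableC; rewrite setCK. Qed.

Lemma compact_cV_measurable (A : set T) : compact A -> measurable A.
Proof.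
move=> cA; apply: closed_cV_measurable.
by apply: compact_closed => //; exact: norm_hausdorff.
Qed.

Lemma within_continuous_measurable_fun (D : set T) (f : T -> R) :
  measurable D -> {within D, continuous f} -> measurable_fun D f.
Proof.
move=> mD /continuousP cf; apply: (measurability _ (RGenOpens.measurableE R)).
move=> _ [_ [a [b ->] <-]].
have /open_subspaceP[V oV VD] := cf _ (@interval_open R (BRight a) (BLeft b) isT isT).
rewrite setIC -VD; apply: measurableI => //; exact: open_cV_measurable.
Qed.

End borel_sets.

Lemma lebesgue_box_fin (R : realType) (n : nat) (e : R) :
  (lebesgue_cV n (box 0 e) < +oo)%E.
Proof.
elim: n => [|n IH]; first by rewrite /= diracE ltry.
rewrite /= /lebesgue_step /pushforward.
have -> : @cons_cV R n @^-1` box 0 e = ball (0 : R) e `*` box 0 e.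
  apply/seteqP; split=> [[a y] ay|[a y] [/= ae ye] i] /=.
    split=> [|i]; first by have := ay ord0; rewrite !mxE unlift_none.
    by have := ay (lift ord0 i); rewrite !mxE liftK.
  rewrite !mxE; case: unliftP => [j|] _ /=; last exact: ae.
  by have := ye j; rewrite !mxE.
rewrite product_measure1E; [|exact: measurable_ball|exact: measurable_box].
have [e0|e0] := leP e 0.
  by rewrite (_ : ball 0 e = set0) ?measure0 ?mul0e//; exact/ball0.
apply: lte_mul_pinfty => //.
have leb : (lebesgue_measure (ball (0%R : R) e) < +oo)%E.
  by rewrite lebesgue_measure_ball ?ltry// ltW.
by rewrite ge0_fin_numE//; exact: leb.
Qed.

Lemma lebesgue_compact_fin (R : realType) (n : nat) (A : set 'cV[R]_n) :
  compact A -> (lebesgue_cV n A < +oo)%E.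
Proof.
move=> cA; have [M [_ MA]] := compact_bounded cA.
(* The bound holds for every number above [M]; a second unit is added below because the box
   inequality is strict. *)
have {}MA x : A x -> `|x| <= M + 1 by apply: MA; lra.
apply: le_lt_trans (lebesgue_box_fin n (M + 2)).
apply: le_measure; rewrite ?inE; [exact: compact_cV_measurable|exact: measurable_box|].
move=> x Ax i; rewrite mxE sub0r normrN.
apply: le_lt_trans (_ : M + 1 < _); last by lra.
apply: le_trans (MA x Ax); rewrite [leRHS]mx_normrE.
by apply: (@le_bigmax _ _ _ 0 (fun ij : 'I_n * 'I_1 => `|x ij.1 ij.2|) (i, 0)).
Qed.

(** * Square-integrable functions on a subset *)

Section L2_space.
Context {R : realType} {n : nat}.
Notation T := 'cV[R]_n.
Notation mu := (lebesgue_cV n).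
Variable Omega : set T.

Let restrictP (a : R) (u w : T -> R) :
  (a *: u + w) \_ Omega = a *: (u \_ Omega) + w \_ Omega.
Proof.
apply/funext => x.
change (((a *: u + w) \_ Omega) x = a * (u \_ Omega) x + (w \_ Omega) x).
by rewrite !patchE; case: ifPn => _ //; rewrite mulr0 addr0.
Qed.

Let L2dotE u w : L2dot Omega u w = \int[mu]_x ((u \_ Omega) x * (w \_ Omega) x).
Proof.
rewrite /L2dot Rintegral_mkcond; apply: eq_Rintegral => x _.
by rewrite !patchE; case: ifPn => _ //; rewrite mulr0.
Qed.

Let L2_integrable u w : L2 Omega u -> L2 Omega w ->
  mu.-integrable setT (EFin \o (fun x => (u \_ Omega) x * (w \_ Omega) x)).
Proof. by move=> Lu Lw; apply/Lfun1_integrable; exact: Lfun2_mul_Lfun1. Qed.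

Lemma L2_psd : psd_form (L2 Omega) (L2dot Omega).
Proof.
have p1 : (1 <= 2%:E :> \bar R)%E by rewrite lee_fin ler1n.
split.
- split.
    rewrite /L2/= (_ : 0 \_ Omega = 0); first exact: (Lfun_submod_closed mu p1).1.
    by apply/funext => x; rewrite patchE; case: ifP.
  move=> a u w Lu Lw; rewrite /L2/= restrictP.
  exact: (Lfun_submod_closed mu p1).2.
- by move=> u w _ _; apply: eq_Rintegral => x _; rewrite mulrC.
- move=> a u w z Lu Lw Lz; rewrite !L2dotE restrictP.
  rewrite -RintegralZl//; last exact: L2_integrable.
  rewrite -RintegralD//; last exact: L2_integrable.
    by apply: eq_Rintegral => x _; rewrite mulrA -mulrDl.
  exact: (integrableZl measurableT a (L2_integrable Lu Lz)).
- by move=> u _; apply: Rintegral_ge0 => x _; rewrite -expr2 sqr_ge0.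
Qed.

Lemma L2norm_ge0 u : 0 <= L2norm Omega u.
Proof. by rewrite fine_ge0// Lnorm_ge0. Qed.

Lemma L2norm_sqr u : L2 Omega u -> L2norm Omega u ^+ 2 = L2dot Omega u u.
Proof.
move=> /[dup] Lu /andP[_]; rewrite inE/= /finite_norm => uoo.
have N0 := Lnorm_ge0 mu 2%:E (EFin \o (u \_ Omega)).
have two0 : (2 : R) != 0 by [].
have := powR_Lnorm mu (EFin \o (u \_ Omega)) two0.
rewrite -(fineK (x := 'N[mu]_2%:E[EFin \o (u \_ Omega)])%E); last by rewrite ge0_fin_numE.
rewrite poweR_EFin powR_mulrn ?fine_ge0// -/(L2norm Omega u) => /(congr1 fine)/= ->.
rewrite L2dotE /Rintegral; congr fine; apply: eq_integral => x _ /=.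
by rewrite powR_mulrn// real_normK ?num_real// expr2.
Qed.

Lemma sqrt_L2dot u : L2 Omega u -> Num.sqrt (L2dot Omega u u) = L2norm Omega u.
Proof. by move=> Lu; rewrite -L2norm_sqr// sqrtr_sqr ger0_norm// L2norm_ge0. Qed.

Lemma L2_bounded (u : T -> R) c : compact Omega -> measurable_fun Omega u -> 0 <= c ->
  (forall x, Omega x -> `|u x| <= c) ->
  L2 Omega u /\ L2norm Omega u <= c * Num.sqrt (fine (mu Omega)).
Proof.
move=> cO mu_ c0 uc.
have mO := compact_cV_measurable cO; have fO := lebesgue_compact_fin cO.
have iu2 : mu.-integrable Omega (EFin \o (fun x => u x ^+ 2)).
  apply: measurable_bounded_integrable => //; first exact: measurable_funX.
  exists (c ^+ 2); split; first exact: num_real.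
  move=> M cM x Ox /=; rewrite normrX (le_trans _ (ltW cM))//.
  by rewrite ler_pXn2r ?nnegrE// uc.
have muO : measurable_fun setT (u \_ Omega).
  by apply/(measurable_restrict u mO measurableT); rewrite setTI.
have Lu : L2 Omega u.
  apply/andP; rewrite !inE/=; split=> //; rewrite /finite_norm unlock poweR_lty//.
  have -> : (\int[mu]_x (`|(EFin \o u \_ Omega) x| `^ 2))%E =
      (\int[mu]_(x in Omega) (u x ^+ 2)%:E)%E.
    rewrite [RHS]integral_mkcond; apply: eq_integral => x _ /=.
    rewrite powR_mulrn// real_normK ?num_real// !patchE; case: ifPn => // _.
    by rewrite expr0n.
  case/integrableP : iu2 => _; apply: le_lt_trans.
  apply: ge0_le_integral => //.
  - by move=> x _; rewrite lee_fin sqr_ge0.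
  - by apply/measurable_EFinP; exact: measurable_funX.
  - by apply/measurable_EFinP; apply: measurableT_comp => //; exact: measurable_funX.
  - by move=> x _; rewrite lee_fin ler_norm.
split=> //.
have ic : mu.-integrable Omega (EFin \o (fun=> c ^+ 2)).
  apply: measurable_bounded_integrable => //.
  exists (c ^+ 2); split; first exact: num_real.
  by move=> M cM x _ /=; rewrite ger0_norm ?exprn_ge0// ltW.
rewrite -(@ler_pXn2r _ 2)// ?nnegrE ?L2norm_ge0 ?mulr_ge0// exprMn.
rewrite sqr_sqrtr ?fine_ge0// L2norm_sqr// -Rintegral_cst// /L2dot.
under eq_Rintegral do rewrite -expr2.
apply: le_Rintegral => // x Ox.
by rewrite -(real_normK (num_real (u x))) ler_pXn2r ?nnegrE// uc.
Qed.

Lemma Linfty_norm_le (u : T -> R) c : 0 <= c -> (forall x, Omega x -> `|u x| <= c) ->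
  (Linfty_norm Omega u <= c%:E)%E.
Proof.
move=> c0 uc; rewrite /Linfty_norm unlock; case: ifPn => _; last by rewrite lee_fin.
apply/ess_supP; apply: nearW => x /=; rewrite lee_fin patchE.
by case: ifPn => [/set_mem/uc//|_]; rewrite normr0.
Qed.

End L2_space.

(** * The reproducing kernel Hilbert space *)

Section kernel_space.
Context {R : realType} {n : nat}.
Notation T := 'cV[R]_n.
Notation mu := (lebesgue_cV n).
Variables (Omega : set T) (K : T -> T -> R).
Hypothesis Omega_compact : compact Omega.
Hypothesis K_sym : forall x y, Omega x -> Omega y -> K x y = K y x.
Hypothesis K_cont : {within Omega `*` Omega, continuous (fun z => K z.1 z.2)}.
Context {H : completeNormedModType R} (dot : {dot H for idfun}) (ev : H -> T -> R).
Hypothesis H_rkhs : is_rkhs Omega K dot ev.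
Let dot_norm := rkhs_norm H_rkhs.
Local Notation kvec := (kernel_vec Omega K dot ev).

Lemma ev_lin a h h' : ev (a *: h + h') = a *: ev h + ev h'.
Proof. by apply/funext => x; rewrite (rkhs_linear H_rkhs). Qed.

Lemma ev_sum N (c : 'I_N -> R) (h : 'I_N -> H) :
  ev (\sum_j c j *: h j) = \sum_j c j *: ev (h j).
Proof.
elim/big_rec2 : _ => [|j u w _ <-]; last exact: ev_lin.
have := ev_lin 1 0 0; rewrite scaler0 addr0 scale1r => ev0.
by apply: (@addrI _ (ev 0)); rewrite -ev0 addr0.
Qed.

Lemma trial_spaceE N (xi : 'I_N -> T) : (forall j, Omega (xi j)) ->
  trial_space Omega K ev xi = lspan (fun j => kvec (xi j)).
Proof.
move=> Oxi.
have E c : ev (\sum_j c j *: kvec (xi j)) = \sum_j c j *: ksec Omega K (xi j).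
  by rewrite ev_sum; apply: eq_bigr => j _; rewrite (kernel_vecP H_rkhs (Oxi j)).1.
apply/seteqP; split=> h [c hc]; exists c; last by rewrite /= hc E.
by apply: (rkhs_inj H_rkhs); rewrite hc E.
Qed.

Lemma kernel_vec_self x : Omega x -> K x x = ev (kvec x) x.
Proof.
by move=> Ox; rewrite -(kernel_vecP H_rkhs Ox).2 dot_kernel_vec.
Qed.

Lemma norm_kernel_vec x : Omega x -> `|kvec x| = Num.sqrt (K x x).
Proof.
move=> Ox; rewrite -(dot_kernel_vec K_sym H_rkhs Ox Ox) dot_norm.
by rewrite sqrtr_sqr normr_id.
Qed.

(** |K_y - K_z|^2 = K(y, y) - 2 K(y, z) + K(z, z), so joint continuity of the kernel at (y, y) is
    enough. It makes all elements of [H] continuous, hence measurable. *)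
Lemma kernel_vec_cvg y : Omega y -> kvec @ within Omega (nbhs y) --> kvec y.
Proof.
move=> Oy; apply/cvgrPdist_lt => e e0.
have e4 : 0 < e ^+ 2 / 4 by rewrite divr_gt0// exprn_gt0.
have /subspace_continuousP/(_ (y, y) (conj Oy Oy))/cvgrPdist_lt := K_cont.
move=> /(_ _ e4)[[P Q] /= [yP yQ] PQ].
rewrite near_withinE; near=> z => Oz.
have Pz : P z by near: z.
have Qz : Q z by near: z.
have Py := nbhs_singleton yP; have Qy := nbhs_singleton yQ.
rewrite -(@ltr_pXn2r _ 2)// ?nnegrE ?(ltW e0)// (normB_dot dot_norm).
rewrite (dot_kernel_vec K_sym H_rkhs Oy Oy) (dot_kernel_vec K_sym H_rkhs Oy Oz).
rewrite (dot_kernel_vec K_sym H_rkhs Oz Oz).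
have := PQ (y, z) (conj Py Qz) (conj Oy Oz).
have := PQ (z, z) (conj Pz Qz) (conj Oz Oz).
rewrite /from_subspace/= !ltr_norml => /andP[? ?] /andP[? ?]; lra.
Unshelve. all: by end_near. Qed.

Lemma ev_continuous h : {within Omega, continuous (ev h)}.
Proof.
apply/subspace_continuousP => y Oy.
change (ev h @ within Omega (nbhs y) --> ev h y).
rewrite -(kernel_vecP H_rkhs Oy).2.
have kh : dot h (kvec z) @[z --> within Omega (nbhs y)] --> dot h (kvec y).
  apply: (dot_cvg dot_norm (f := fun=> h)); first exact: cvg_cst.
  exact: kernel_vec_cvg.
apply: cvg_trans kh; apply: near_eq_cvg.
by rewrite near_withinE; near=> z => Oz; rewrite (kernel_vecP H_rkhs Oz).2.
Unshelve. all: by end_near. Qed.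

Lemma ev_L2 h c : 0 <= c -> (forall x, Omega x -> `|ev h x| <= c) ->
  L2 Omega (ev h) /\ L2norm Omega (ev h) <= c * Num.sqrt (fine (mu Omega)).
Proof.
apply: L2_bounded => //; apply: within_continuous_measurable_fun.
  exact: compact_cV_measurable.
exact: ev_continuous.
Qed.

Hypothesis K_bounded : bounded_diagonal Omega K.

Lemma ev_bounded : exists2 c, 0 <= c &
  forall h x, Omega x -> `|ev h x| <= c * `|h|.
Proof.
have [c Kc] := K_bounded; exists (Num.sqrt c); first exact: sqrtr_ge0.
move=> h x Ox; rewrite -(kernel_vecP H_rkhs Ox).2.
rewrite (le_trans (le_dot_norm dot_norm _ _))// mulrC ler_wpM2r//.
by rewrite norm_kernel_vec// ler_wsqrtr// Kc.
Qed.

Lemma ev_in_L2 h : L2 Omega (ev h).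
Proof.
have [c c0 ec] := ev_bounded.
by apply: (ev_L2 (c := c * `|h|) _ _).1; rewrite ?mulr_ge0// => x; exact: ec.
Qed.

Lemma L2dot_le u w : L2 Omega u -> L2 Omega w ->
  `|L2dot Omega u w| <= L2norm Omega u * L2norm Omega w.
Proof.
move=> Lu Lw; rewrite -(@ler_pXn2r _ 2)// ?nnegrE ?mulr_ge0 ?L2norm_ge0//.
rewrite real_normK ?num_real// exprMn !L2norm_sqr//.
exact: (psd_cauchy_schwarz (L2_psd Omega)).
Qed.

(* The elements h satisfying the identity form a closed subspace of H which
   contains every section of the kernel. *)
Lemma dot_integral_op v p : L2 Omega p -> ev v = integral_op Omega K p ->
  forall h, dot h v = L2dot Omega (ev h) p.
Proof.
move=> Lp vp.
pose phi h := dot h v - L2dot Omega (ev h) p.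
have phi_lin a h h' : phi (a *: h + h') = a * phi h + phi h'.
  rewrite /phi (dotDl dot_norm) (dotZl dot_norm) ev_lin.
  rewrite (psd_linear (L2_psd Omega))//; [ring|exact: ev_in_L2..].
have phiB h h' : phi (h - h') = phi h - phi h'.
  by rewrite addrC -scaleN1r phi_lin mulN1r addrC.
have [c c0 ec] := ev_bounded.
(* The summand 1 in the witness makes [M] positive, since closedness of [S] divides by it. *)
have [M M0 phiM] : exists2 M, 0 < M & forall h, `|phi h| <= M * `|h|.
  exists (`|v| + c * Num.sqrt (fine (mu Omega)) * L2norm Omega p + 1).
    by rewrite ltr_wpDl// addr_ge0// !mulr_ge0// ?sqrtr_ge0// L2norm_ge0.
  move=> h; rewrite (le_trans (ler_normB _ _))// 2!mulrDl mul1r.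
  apply: le_trans (_ : _ <= `|v| * `|h| +
    c * Num.sqrt (fine (mu Omega)) * L2norm Omega p * `|h|) _; last by rewrite lerDl.
  apply: lerD; first by rewrite mulrC; exact: le_dot_norm.
  apply: le_trans (L2dot_le (ev_in_L2 h) Lp) _.
  rewrite mulrAC ler_wpM2r ?L2norm_ge0// mulrAC.
  by apply: (ev_L2 _ _).2; rewrite ?mulr_ge0// => x; exact: ec.
pose S := [set h | phi h = 0].
have Ssub : linear_subspace S.
  split=> [|a x y Sx Sy]; first by rewrite /S/= -(subrr 0) phiB subrr.
  by rewrite /S/= phi_lin (Sx : phi x = 0) (Sy : phi y = 0) mulr0 addr0.
have Scl : closed S.
  move=> h hS; apply/eqP/negPn/negP => ph.
  have e0 : 0 < `|phi h| / M by rewrite divr_gt0// normr_gt0.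
  have [s [/= Ss]] := hS _ (nbhsx_ballx h _ e0).
  rewrite -ball_normE /= ltr_pdivlMr// mulrC => hs.
  have := phiM (h - s); rewrite phiB (Ss : phi s = 0) subr0.
  by move=> /le_lt_trans/(_ hs); rewrite ltxx.
have kS y : Omega y -> S (kvec y).
  move=> Oy; rewrite /S/= /phi (dotC dot_norm) (kernel_vecP H_rkhs Oy).2.
  rewrite (kernel_vecP H_rkhs Oy).1 vp /integral_op patchE mem_set//.
  apply/eqP; rewrite subr_eq0; apply/eqP; apply: eq_Rintegral => x /set_mem Ox.
  by rewrite /ksec patchE mem_set// K_sym.
move=> h; apply/subr0_eq; rewrite -/(phi h).
(* [h - s] is orthogonal to all kernel sections, so it vanishes at every point and [h] lies in
   [S]. *)
have [s [Ss hs]] := closed_projection dot_norm Ssub Scl h.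
suff -> : h = s by [].
apply/subr0_eq/(rkhs_inj H_rkhs)/funext => x.
have ev0 : ev 0 = 0 by have := @ev_sum 0 (fun=> 0) (fun=> 0); rewrite !big_ord0.
rewrite ev0; have [Ox|Ox] := pselect (Omega x); last exact: (rkhs_support H_rkhs).
by rewrite -(kernel_vecP H_rkhs Ox).2 hs//; exact: kS.
Qed.

End kernel_space.

(** * Stability of the Galerkin scheme *)

Section galerkin_stability.
Context {R : realType} {V : lmodType R} (D : set V) (q : V -> V -> R).
Hypothesis qD : psd_form D q.
Context {H : completeNormedModType R} (A : H -> V).
Hypothesis A_linear : forall a x y, A (a *: x + y) = a *: A x + A y.
Hypothesis A_data : forall h, D (A h).

Let A0 : A 0 = 0.
Proof.
have := A_linear 1 0 0; rewrite scaler0 addr0 scale1r => A00.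
by apply: (@addrI _ (A 0)); rewrite -A00 addr0.
Qed.

(* If q (A h) (A h) = 0, then A h and 0 have the same set of projections, hence
   the same chosen one, and injectivity gives h = 0. *)
Lemma galerkin_image_definite N (k : 'I_N -> H) (S := lspan (A \o k)) :
  set_bij (lspan k) S (orth_proj q S \o A) ->
  forall s, S s -> q s s = 0 -> s = 0.
Proof.
move=> [_ inj _] s Ss ss.
have Asum c : A (\sum_j c j *: k j) = \sum_j c j *: A (k j).
  by elim/big_rec2 : _ => [|j u w _ <-]; [exact: A0|exact: A_linear].
have SD : S `<=` D := lspan_sub (psd_sub qD) (fun j => A_data (k j)).
have [c sc] := Ss; pose h := \sum_j c j *: k j.
have sh : s = A h by rewrite sc Asum.
have PP : orth_proj q S (A h) = orth_proj q S (A 0).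
  have qs0 p t : S p -> S t -> q (s - p) t = q (0 - p) t.
    move=> /SD Dp /SD Dt.
    rewrite (psdBl qD (SD _ Ss) Dp Dt) (psdBl qD (psd_sub qD).1 Dp Dt).
    by rewrite (psd0l qD Dt) (psd_null qD (SD _ Ss) Dt ss).
  congr (xget 0 _); apply/seteqP; split=> p [Sp pP]; split=> // t St.
    rewrite A0 -(pP t St) -sh; by apply/esym/qs0.
  by rewrite -sh -(pP t St) A0; exact: qs0.
rewrite sh (inj h 0 _ _ PP) ?A0// inE.
  by exists c.
exact: (subspace_lspan k).1.
Qed.

Variables (CA : R) (N0 : nat) (e : forall N, 'I_N -> V) (HS : nat -> set H).
Hypothesis CA_ge0 : 0 <= CA.
Hypothesis A_bounded : forall h, Num.sqrt (q (A h) (A h)) <= CA * `|h|.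
Hypothesis De : forall N j, (N0 <= N)%N -> D (@e N j).
Hypothesis q_definite : forall N s, (N0 <= N)%N ->
  lspan (@e N) s -> q s s = 0 -> s = 0.
Hypothesis HS_sub : forall N, (N0 <= N)%N -> linear_subspace (HS N).
Let P N := orth_proj q (lspan (@e N)).
Hypothesis bij : forall N, (N0 <= N)%N ->
  set_bij (HS N) (lspan (@e N)) (P N \o A).
Hypothesis G_cvg : forall h, cvg (galerkin A (HS N) (P N) (A h) @[N --> \oo]).

Lemma galerkin_uniformly_bounded : exists2 M, 0 <= M &
  forall N h, (N0 <= N)%N -> `|galerkin A (HS N) (P N) (A h)| <= M * `|h|.
Proof.
pose GA N h := galerkin A (HS N) (P N) (A h).
have GA_lin N a x y : (N0 <= N)%N -> GA N (a *: x + y) = a *: GA N x + GA N y.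
  move=> N0N; rewrite /GA A_linear.
  apply: (galerkin_linear qD (fun j => De j N0N) _ A_linear A_data
    (HS_sub N0N) (bij N0N)) => //.
  by move=> s; exact: q_definite.
(* Indices below [N0] are excluded because linearity is available only where the scheme is
   well-defined. Pointwise bounds come from convergence of [GA N x] in N. *)
pose F := [set f | exists2 N, (N0 <= N)%N & f = GA N].
have [M MF] : exists M, forall f, F f -> forall x, `|x| <= 1 -> `|f x| <= M.
  apply: Banach_Steinhauss => [_ [N N0N ->]|x].
    split; last by move=> a x y; exact: GA_lin.
    have [C C0 CG] := galerkin_bounded qD (fun j => De j N0N)
      (fun s => q_definite N0N) A_linear A_data (HS_sub N0N) (bij N0N).
    move=> r; exists (C * (CA * r)) => x xr.
    rewrite (le_trans (CG _ (A_data x)))// ler_wpM2l//.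
    by rewrite (le_trans (A_bounded x))// ler_wpM2l.
  have [M [_ /(_ (M + 1))]] := cvg_seq_bounded (@G_cvg x).
  rewrite ltrDl => /(_ ltr01) MG; exists (M + 1) => _ [N _ ->].
  exact: MG.
(* The bound on the unit ball has no known sign, hence the absolute value; homogeneity extends it to
   all of [H]. *)
exists `|M| => // N h N0N; rewrite -/(GA N h).
have GA0 : GA N 0 = 0.
  have := GA_lin N 1 0 0 N0N; rewrite scaler0 addr0 scale1r => GA00.
  by apply: (@addrI _ (GA N 0)); rewrite -GA00 addr0.
have [->|h0] := eqVneq h 0; first by rewrite GA0 !normr0 mulr0.
have hn : `|h| != 0 by rewrite normr_eq0.
have {1}-> : h = `|h| *: (`|h|^-1 *: h) + 0 by rewrite addr0 scalerA divff// scale1r.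
rewrite GA_lin// GA0 addr0 normrZ normr_id mulrC ler_wpM2r//.
rewrite (le_trans _ (ler_norm M))//; apply: MF; first by exists N.
by rewrite normrZ normfV normr_id mulVf.
Qed.

End galerkin_stability.

(** * The critic and actor operators *)

Section native_projection.
Context {R : realType} {n : nat}.
Notation T := 'cV[R]_n.
Context {H : completeNormedModType R} (dot : {dot H for idfun}).
Hypothesis dot_norm : forall h, dot h h = `|h| ^+ 2.
Variables (Omega : set T) (al : T -> H) (k : T -> T -> R).
Hypothesis kE : forall x y, Omega x -> Omega y -> k x y = dot (al x) (al y).
Local Notation B := (pairing_op dot Omega al).

Lemma ksec_pairing y : Omega y -> ksec Omega k y = B (al y).
Proof.
move=> Oy; apply/funext => x; rewrite /ksec /pairing_op !patchE.
by case: ifPn => // /set_mem Ox; rewrite kE// (dotC dot_norm).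
Qed.

Lemma range_ksec y : Omega y -> range B (ksec Omega k y).
Proof. by move=> Oy; exists (al y) => //; rewrite ksec_pairing. Qed.

Lemma qdot_lspan_definite M (om : 'I_M -> T) : (forall j, Omega (om j)) ->
  forall s, lspan (fun j => ksec Omega k (om j)) s -> qdot B s s = 0 -> s = 0.
Proof.
move=> Oom s Ss; apply: (qdot_definite dot_norm).
apply: (lspan_sub (range_pairing_sub dot_norm _ _)) Ss => j.
exact: range_ksec.
Qed.

Lemma native_projection_error M (om : 'I_M -> T) c v w :
  (forall j, Omega (om j)) -> (forall x, Omega x -> Num.sqrt (k x x) <= c) ->
  let S := lspan (fun j => ksec Omega k (om j)) in
  forall x, Omega x ->
  `|(B v - orth_proj (qdot B) S (B w)) x| <=
    sup [set power_function (qdot B) id k S x | x in Omega] * qnorm B (B v) +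
    c * `|v - w|.
Proof.
move=> Oom kc S x Ox.
have qD := qdot_psd dot_norm Omega al.
have De j : range B (ksec Omega k (om j)) by exact: range_ksec.
have def := qdot_lspan_definite Oom.
have SD : S `<=` range B by exact: lspan_sub (psd_sub qD) _ _ De.
have rB h : range B (B h) by exists h.
pose P := orth_proj (qdot B) S.
have PS y : range B y -> S (P y) by move=> By; exact: (orth_projP qD De By).1.
have xk y : Omega y -> k y y = B (al y) y.
  by move=> Oy; rewrite pairing_opE// kE.
have repr y : Omega y -> forall h, range B h -> qdot B h (B (al y)) = h y.
  by move=> Oy h Bh; exact: qdot_repr.
have Bvw : range B (B v - B w) by exact: (subspaceB (psd_sub qD)).
have -> : B v - P (B w) = (B v - P (B v)) + P (B v - B w).
  have -> : B v - B w = (-1) *: B w + B v by rewrite scaleN1r addrC.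
  by rewrite /P (orth_proj_linear qD De def)// scaleN1r addrA addrAC subrK.
have evD (f f' : T -> R) : (f + f') x = f x + f' x by [].
rewrite evD (le_trans (ler_normD _ _))// lerD//.
  have BvP : range B (B v - P (B v)).
    by apply: (subspaceB (psd_sub qD)) => //; exact/SD/PS.
  have := le_power_function qD De def (ev := id) (rB (al x)) (repr x Ox) (xk x Ox)
    BvP (orth_projP qD De (rB v)).2.
  move/le_trans; apply; rewrite mulrC; apply: ler_pM.
  - exact: sqrtr_ge0.
  - exact: sqrtr_ge0.
  (* The supremum of the power function is finite because [c], a bound for the square root of the
     kernel diagonal, also bounds the power function. *)
  - apply: ub_le_sup; last by exists x.
    exists c => _ [y Oy <-]; apply: le_trans (kc y Oy).
    exact: (power_function_le qD De def (ev := id) (rB (al y)) (repr y Oy) (xk y Oy)).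
  - rewrite -(sqrt_qdot dot_norm) ler_wsqrtr//.
    exact: (le_orth_projB_norm qD De (rB v)).
have BP : range B (P (B v - B w)) by exact/SD/PS.
rewrite -(repr x Ox _ BP) mulrC.
apply: le_trans (_ : Num.sqrt (qdot B (P (B v - B w)) (P (B v - B w))) *
  Num.sqrt (qdot B (B (al x)) (B (al x))) <= _).
  rewrite -sqrtrM; last exact: (psd_ge0 qD).
  by rewrite -sqrtr_sqr ler_wsqrtr// (psd_cauchy_schwarz qD).
apply: ler_pM; rewrite ?sqrtr_ge0//; last by rewrite (repr x Ox)// -xk// kc.
apply: le_trans (_ : Num.sqrt (qdot B (B v - B w) (B v - B w)) <= _).
  by rewrite ler_wsqrtr//; exact: (le_orth_proj_norm qD De Bvw).
rewrite -(pairing_opB dot_norm) (sqrt_qdot dot_norm).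
exact: qnorm_pairing_le.
Qed.

End native_projection.

Section first_order_operators.
Context {R : realType} {n m : nat}.
Notation T := 'cV[R]_n.
Context {H : completeNormedModType R} (dot : {dot H for idfun}).
Hypothesis dot_norm : forall h, dot h h = `|h| ^+ 2.
Variables (Omega : set T) (K : T -> T -> R) (ev : H -> T -> R).
Variable d : 'I_n -> T -> H.
Hypothesis partialP : forall i x h, Omega x ->
  partial Omega i (ev h) x = dot h (d i x).
Hypothesis partial2P : forall i j x y, Omega x -> Omega y ->
  dot (d i x) (d j y) = partial2 Omega K i j x y.

Let dot_sum (b c : 'I_n -> R) x y : Omega x -> Omega y ->
  dot (\sum_k b k *: d k x) (\sum_l c l *: d l y) =
  \sum_k \sum_l b k * partial2 Omega K k l x y * c l.
Proof.
move=> Ox Oy; rewrite (psd_suml (dot_psd dot_norm))//; apply: eq_bigr => k _.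
rewrite (dotZl dot_norm) (dot_sumr dot_norm) mulr_sumr; apply: eq_bigr => l _.
by rewrite (dotZr dot_norm) partial2P//; ring.
Qed.

Definition critic_vec (a : T -> T) (x : T) : H := \sum_k a x k 0 *: d k x.

Lemma critic_opE a h :
  critic_op Omega a (ev h) = pairing_op dot Omega (critic_vec a) h.
Proof.
apply/funext => x; rewrite /critic_op /pairing_op !patchE.
case: ifPn => // /set_mem Ox; rewrite mxE (dot_sumr dot_norm).
by apply: eq_bigr => k _; rewrite !mxE partialP// (dotZr dot_norm).
Qed.

Lemma critic_kernelE a x y : Omega x -> Omega y ->
  critic_kernel Omega K a x y = dot (critic_vec a x) (critic_vec a y).
Proof. by move=> Ox Oy; rewrite dot_sum. Qed.

Definition actor_coef (g : T -> 'M[R]_(n, m)) (Rm : 'M[R]_m) i x (k : 'I_n) : R :=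
  - 2^-1 * \sum_j invmx Rm i j * g x k j.

Definition actor_vec g Rm i (x : T) : H := \sum_k actor_coef g Rm i x k *: d k x.

Lemma actor_opE g Rm i h :
  actor_op Omega g Rm i (ev h) = pairing_op dot Omega (actor_vec g Rm i) h.
Proof.
apply/funext => x; rewrite /actor_op /pairing_op !patchE.
case: ifPn => // /set_mem Ox; rewrite !mxE (dot_sumr dot_norm) mulr_sumr.
apply: eq_bigr => k _; rewrite !mxE partialP// (dotZr dot_norm) mulrA.
by congr (_ * _ * _); apply: eq_bigr => j _; rewrite mxE.
Qed.

Lemma actor_kernelE g Rm i x y : Omega x -> Omega y ->
  actor_kernel Omega K g Rm i x y = dot (actor_vec g Rm i x) (actor_vec g Rm i y).
Proof.
move=> Ox Oy; rewrite dot_sum// /actor_kernel.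
(* The derivative directions are moved outermost to match the expansion of [dot]; 4^-1 is then the
   product of the two factors - 2^-1. *)
transitivity (4^-1 * \sum_k \sum_t \sum_j \sum_l
  invmx Rm i j * g x k j * partial2 Omega K k t x y * g y t l * invmx Rm i l).
  congr (_ * _); rewrite (eq_bigr _ (fun j _ => exchange_big _ _ _ _ _ _)) /=.
  rewrite exchange_big /=; apply: eq_bigr => k _.
  rewrite (eq_bigr _ (fun j _ => exchange_big _ _ _ _ _ _)) /=.
  by rewrite exchange_big.
rewrite mulr_sumr; apply: eq_bigr => k _; rewrite mulr_sumr; apply: eq_bigr => t _.
rewrite /actor_coef.
set s := \sum_j invmx Rm i j * g x k j; set s' := \sum_j invmx Rm i j * g y t j.
have -> : - 2^-1 * s * partial2 Omega K k t x y * (- 2^-1 * s') =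
  4^-1 * (s * partial2 Omega K k t x y * s') by field.
congr (_ * _); rewrite /s !mulr_suml; apply: eq_bigr => j _.
rewrite /s' mulr_sumr; apply: eq_bigr => l _; ring.
Qed.

End first_order_operators.

(** * Assembly of the two error bounds *)

Lemma Ck_on_continuous (R : realType) (V : normedModType R) (J : Type)
    (e : J -> V) (D : set V) k (f : V -> R) :
  Ck_on e D k f -> {within D, continuous f}.
Proof. by case: k => [|k] []. Qed.

(** If the image is empty or unbounded, [sup] takes its default value 0. *)
Lemma sup_image_ge0 (R : realType) (T : Type) (A : set T) (f : T -> R) :
  (forall x, A x -> 0 <= f x) -> 0 <= sup [set f x | x in A].
Proof.
move=> f0; have [supE|?] := pselect (has_sup [set f x | x in A]); last by rewrite sup_out.
have [[_ [x Ax _]] _] := supE.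
by apply: le_trans (f0 x Ax) _; apply: ub_le_sup; [exact: supE.2|exists x].
Qed.

Theorem theorem4 (R : realType) (n m s : nat) (hs : (1 <= s)%N)
    (Omega : set 'cV[R]_n)
    (Omega_compact : compact Omega)
    (Omega_sc : @simply_connected R _ Omega)
    (Omega_closure : Omega = closure Omega°)
    (K : 'cV[R]_n -> 'cV[R]_n -> R)
    (K_sym : forall x y, Omega x -> Omega y -> K x y = K y x)
    (K_pos : strictly_positive Omega K)
    (K_bounded : bounded_diagonal Omega K)
    (K_smooth : Ck_on (@unit_vec2 R n) (Omega `*` Omega) (2 * s)
                  (fun z => K z.1 z.2))
    (H : completeNormedModType R) (dot : {dot H for idfun})
    (ev : H -> 'cV[R]_n -> R) (H_rkhs : is_rkhs Omega K dot ev)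
    (f : 'cV[R]_n -> 'cV[R]_n) (g : 'cV[R]_n -> 'M[R]_(n, m))
    (nu : 'cV[R]_n -> 'cV[R]_m)
    (Rm : 'M[R]_m) (Rm_sym : Rm^T = Rm) (Rm_posdef : posdef Rm)
    (N0 : nat) (Xi : forall N, 'I_N -> 'cV[R]_n)
    (Xi_inj : forall N, (N0 <= N)%N -> injective (Xi N))
    (Xi_Omega : forall N j, (N0 <= N)%N -> Omega (Xi N j))
    (omega : forall M, 'I_M -> 'cV[R]_n)
    (omega_Omega : forall M k, Omega (omega M k))
    (meth : critic_method) :
  let a := closed_loop f g nu in
  let A (h : H) := critic_op Omega a (ev h) in
  let HN N := trial_space Omega K ev (Xi N) in
  let YN N := test_space Omega K a meth (Xi N) in
  let PN N := orth_proj (data_dot Omega a ev meth) (YN N) in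
  let B (i : 'I_m) (h : H) := actor_op Omega g Rm i (ev h) in
  let u (i : 'I_m) := actor_kernel Omega K g Rm i in
  let U (i : 'I_m) M := lspan (fun k => ksec Omega (u i) (omega M k)) in
  let PU (i : 'I_m) M := orth_proj (qdot (B i)) (U i M) in
  (* W is continuously embedded in C(Omega) *)
  (forall h, {within Omega, continuous (A h)}) ->
  (exists c : R, forall w x, range A w -> Omega x -> `|w x| <= c * qnorm A w) ->
  (forall i, bounded_diagonal Omega (u i)) ->
  (forall N, (N0 <= N)%N -> HN N `<=` orthocomplement dot (nullspace A)) ->
  forall (b : 'cV[R]_n -> R) (v : H) (p : 'cV[R]_n -> R),
  A v = b -> L2 Omega p -> ev v = integral_op Omega K p ->
  galerkin_convergent dot A N0 HN YN PN ->
  (forall i w, range (B i) w ->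
    qnorm (B i) (PU i M w - w) @[M --> \oo] --> (0 : R)) ->
  exists (C : nat -> R) (Cu Cv Cv' : R),
    [/\ forall N, 0 < C N, 0 < Cu, 0 < Cv & 0 < Cv'] /\
    forall bdelta, data_space Omega a ev meth bdelta ->
    forall (i : 'I_m) (M N : nat), (N0 <= N)%N ->
      let delta := data_norm Omega a ev meth (b - bdelta) in
      let vN := galerkin A (HN N) (PN N) bdelta in
      let mu := B i v in
      let muMN := PU i M (B i vN) in
      let supPU := sup [set power_function (qdot (B i)) id (u i) (U i M) x
                       | x in Omega] in
      let supPH := sup [set power_function dot ev K (HN N) x | x in Omega] in
      (Linfty_norm Omega (mu - muMN)%R <=
        (Cu * supPU * qnorm (B i) mu + Cv * `|v - vN|)%R%:E)%E /\
      Cu * supPU * qnorm (B i) mu + Cv * `|v - vN| <=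
        C N * delta + Cv' * supPH * L2norm Omega p
          + Cu * supPU * qnorm (B i) mu.
Proof.
move=> a A HN YN PN B u U PU A_cont [cW A_emb] u_bdd _ b v p Avb Lp vp conv _.
have dot_norm := rkhs_norm H_rkhs.
have [K1 [K2 [K1P K1c K2P K2c]]] := Ck_on_mixed hs K_smooth.
have K_cont := Ck_on_continuous K_smooth.
pose d := derivative_vec Omega K dot ev.
have dP i x h : Omega x -> partial Omega i (ev h) x = dot h (d i x).
  exact: (partial_dot Omega_closure K_sym H_rkhs K1P K2P K2c).
have d2P i j x y : Omega x -> Omega y ->
    dot (d i x) (d j y) = partial2 Omega K i j x y.
  exact: (dot_derivative_vec Omega_closure K_sym H_rkhs K1P K1c K2P K2c).
pose alA := critic_vec d a; pose be i := actor_vec d g Rm i.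
have AE : A = pairing_op dot Omega alA.
  by apply/funext => h; exact: (critic_opE dot_norm dP).
have BE i : B i = pairing_op dot Omega (be i).
  by apply/funext => h; exact: (actor_opE dot_norm dP).
have wE x y : Omega x -> Omega y ->
    critic_kernel Omega K a x y = dot (alA x) (alA y).
  exact: (critic_kernelE dot_norm d2P).
have uE i x y : Omega x -> Omega y -> u i x y = dot (be i x) (be i y).
  exact: (actor_kernelE dot_norm d2P).
have A_linear c h h' : A (c *: h + h') = c *: A h + A h'.
  by rewrite AE (pairing_op_linear dot_norm).
have qA_le h : qnorm A (A h) <= `|h| by rewrite AE; exact: qnorm_pairing_le.
have qA_ge0 h : 0 <= qnorm A (A h).
  by rewrite AE -(sqrt_qdot dot_norm) sqrtr_ge0.
have A_sup h x : Omega x -> `|A h x| <= `|cW| * `|h|.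
  move=> Ox; have rAh : range A (A h) by exists h.
  rewrite (le_trans (A_emb _ _ rAh Ox))// (le_trans (ler_norm _))// normrM.
  by rewrite ler_wpM2l// ger0_norm.
have A_L2 h : L2 Omega (A h) /\
    L2norm Omega (A h) <= `|cW| * `|h| * Num.sqrt (fine (lebesgue_cV n Omega)).
  apply: L2_bounded => //; rewrite ?mulr_ge0//; last exact: A_sup.
  by apply: within_continuous_measurable_fun => //; exact: compact_cV_measurable.
pose D := data_space Omega a ev meth; pose q := data_dot Omega a ev meth.
have qD : psd_form D q.
  rewrite /D /q; case: (meth); last exact: L2_psd.
  by change (psd_form (range A) (qdot A)); rewrite AE; exact: qdot_psd.
have qN w : D w -> Num.sqrt (q w w) = data_norm Omega a ev meth w.
  rewrite /D /q; case: (meth); last exact: sqrt_L2dot.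
  change (range A w -> Num.sqrt (qdot A w w) = qnorm A w).
  by rewrite AE => -[h _ <-]; exact: (sqrt_qdot dot_norm).
have A_data h : D (A h).
  by rewrite /D; case: (meth); [exists h|exact: (A_L2 h).1].
have [CA CA0 A_bdd] : exists2 CA, 0 <= CA &
    forall h, Num.sqrt (q (A h) (A h)) <= CA * `|h|.
  (* One constant serves both methods: 1 bounds the quotient norm, and the embedding constant times
     the root of the volume bounds the L2 norm. *)
  exists (1 + `|cW| * Num.sqrt (fine (lebesgue_cV n Omega))).
    by rewrite addr_ge0// mulr_ge0// sqrtr_ge0.
  move=> h; rewrite qN//; case: (meth) => /=.
    rewrite mulrDl mul1r ler_wpDr// !mulr_ge0// sqrtr_ge0.
  rewrite mulrDl mulrAC ler_wpDl// ?mul1r//; exact: (A_L2 h).2.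
pose kv := kernel_vec Omega K dot ev.
have kvP y := kernel_vecP H_rkhs (y := y).
have HNE N : (N0 <= N)%N -> HN N = lspan (fun j => kv (Xi N j)).
  by move=> N0N; apply: (trial_spaceE H_rkhs) => j; exact: Xi_Omega.
pose eN N j : 'cV[R]_n -> R := match meth with
  | C1 => ksec Omega (critic_kernel Omega K a) (Xi N j)
  | C2 => critic_op Omega a (ksec Omega K (Xi N j)) end.
have YNE N : YN N = lspan (eN N) by rewrite /YN /eN; case: (meth).
have eN2 N j : (N0 <= N)%N ->
    critic_op Omega a (ksec Omega K (Xi N j)) = A (kv (Xi N j)).
  by move=> N0N; rewrite /A (kvP _ (Xi_Omega N j N0N)).1.
have De N j : (N0 <= N)%N -> D (eN N j).
  move=> N0N; rewrite /D /eN; case: (meth) => /=; last first.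
    by rewrite eN2//; exact: (A_L2 _).1.
  change (range A (ksec Omega (critic_kernel Omega K a) (Xi N j))).
  by rewrite AE; apply: (range_ksec dot_norm wE); exact: Xi_Omega.
have [bij G_cvg] := conv.
(* For C1 definiteness holds on the whole range. For C2 a function can vanish almost everywhere
   without being 0, so the bijectivity assumed of the scheme is used. *)
have q_def N s0 : (N0 <= N)%N -> lspan (eN N) s0 -> q s0 s0 = 0 -> s0 = 0.
  move=> N0N; have := bij N N0N; rewrite /PN YNE HNE// -/q /q /eN.
  move: qD A_data; rewrite /D /q; case: (meth) => qD' A_data'.
    move=> _.
    change (lspan (fun j => ksec Omega (critic_kernel Omega K a) (Xi N j)) s0 ->
      qdot A s0 s0 = 0 -> s0 = 0).
    rewrite AE; apply: (qdot_lspan_definite dot_norm wE) => j.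
    exact: Xi_Omega.
  have -> : lspan (fun j => critic_op Omega a (ksec Omega K (Xi N j))) =
      lspan (A \o (fun j => kv (Xi N j))).
    by apply: lspan_eq => j; exact: eN2.
  by move=> bijN; exact: (galerkin_image_definite qD' A_linear A_data' bijN).
have HN_sub N : (N0 <= N)%N -> linear_subspace (HN N).
  by move=> N0N; rewrite HNE//; exact: subspace_lspan.
have PNE : PN = fun N => orth_proj q (lspan (eN N)).
  by apply/funext => N; rewrite /PN YNE.
have bij' N : (N0 <= N)%N ->
    set_bij (HN N) (lspan (eN N)) (orth_proj q (lspan (eN N)) \o A).
  by move=> N0N; have := bij N N0N; rewrite PNE YNE.
pose G N := galerkin A (HN N) (orth_proj q (lspan (eN N))).
have G_cvg' h : cvg (G N (A h) @[N --> \oo]).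
  have rAh : range A (A h) by exists h.
  by move: (G_cvg _ rAh); rewrite PNE => /cvgP.
have [M M0 GM] := galerkin_uniformly_bounded qD A_linear A_data CA0 A_bdd De
  q_def HN_sub bij' G_cvg'.
have G_lin N c y z : (N0 <= N)%N -> D y -> D z ->
    G N (c *: y + z) = c *: G N y + G N z.
  move=> N0N; exact: (galerkin_linear qD (fun j => De N j N0N)
    (fun s0 => q_def N s0 N0N) A_linear A_data (HN_sub N N0N) (bij' N N0N)).
have GK N h : (N0 <= N)%N -> HN N h -> G N (A h) = h.
  by move=> N0N; exact: (galerkinK A_data (bij' N N0N)).
(* Boundedness is local to each [N], so the constants are gathered by choice, with the dummy value 0
   below [N0]. *)
have /choice[Cg CgP] N : exists C, 0 <= C /\ ((N0 <= N)%N ->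
    forall y, D y -> `|G N y| <= C * Num.sqrt (q y y)).
  have [N0N|_] := boolP (N0 <= N)%N; last by exists 0.
  have [C C0 CG] := galerkin_bounded qD (fun j => De N j N0N)
    (fun s0 => q_def N s0 N0N) A_linear A_data (HN_sub N N0N) (bij' N N0N).
  by exists C.
have [cU cU0 cUP] : exists2 c, 0 < c &
    forall i x, Omega x -> Num.sqrt (u i x x) <= c.
  have /choice[cu cuP] := u_bdd.
  (* Summing over the finitely many components gives a constant independent of [i]; the 1 keeps it
     positive even for [m = 0]. *)
  exists (1 + \sum_i Num.sqrt (cu i)).
    by rewrite ltr_pwDl// sumr_ge0// => i _; rewrite sqrtr_ge0.
  move=> i x Ox; rewrite (bigD1 i)//= addrA addrAC.
  by rewrite (le_trans (ler_wsqrtr (cuP i x Ox)))// lerDr addr_ge0// sumr_ge0//.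
pose om := Num.sqrt (fine (lebesgue_cV n Omega)).
have om0 : 0 <= om by rewrite sqrtr_ge0.
(* The added units give strict positivity when [Cg N] or the volume is 0. *)
exists (fun N => cU * Cg N + 1), 1, cU, (cU * (1 + M) * om + 1); split.
  split=> // [N|].
    by rewrite ltr_wpDl// mulr_ge0 ?(ltW cU0)//; case: (CgP N).
  by rewrite ltr_wpDl// !mulr_ge0 ?addr_ge0 ?(ltW cU0).
move=> bdelta bD i M' N N0N delta vN mu muMN supPU supPH.
have vNE : vN = G N bdelta by rewrite /vN PNE.
have supPU0 : 0 <= supPU by apply: sup_image_ge0 => x _; exact: sqrtr_ge0.
have supPH0 : 0 <= supPH by apply: sup_image_ge0 => x _; exact: sqrtr_ge0.
have mu0 : 0 <= qnorm (B i) mu.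
  by rewrite /mu BE -(sqrt_qdot dot_norm) sqrtr_ge0.
split.
  rewrite mul1r; apply: Linfty_norm_le.
    by rewrite addr_ge0// mulr_ge0// ltW.
  move=> x Ox.
  have := native_projection_error dot_norm (uE i) v vN (omega_Omega M') (cUP i) Ox.
  by rewrite -(BE i).
have bAv : D (b - bdelta) by rewrite -Avb; exact: (subspaceB (psd_sub qD)).
have deltaE : Num.sqrt (q (b - bdelta) (b - bdelta)) = delta by exact: qN.
have delta0 : 0 <= delta by rewrite -deltaE sqrtr_ge0.
have dD := dot_psd dot_norm.
pose kN j := kv (Xi N j).
pose e := v - orth_proj dot (HN N) v.
have [piS e_perp] : HN N (orth_proj dot (HN N) v) /\
    forall s0, HN N s0 -> dot e s0 = 0.
  by rewrite /e HNE//; exact: (orth_projP dD (e := kN)).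
have ev_e x : Omega x -> `|ev e x| <= `|e| * supPH.
  move=> Ox.
  have def (s0 : H) : lspan kN s0 -> dot s0 s0 = 0 -> s0 = 0.
    by move=> _; exact: (dot_eq0 dot_norm).
  have kx y (Oy : Omega y) h (_ : [set: H] h) := (kvP y Oy).2 h.
  have e_perp' s0 : lspan kN s0 -> dot e s0 = 0 by rewrite -HNE//; exact: e_perp.
  have := le_power_function dD (fun=> I) def (ev := ev) (k := K) I (kx x Ox)
    (kernel_vec_self K_sym H_rkhs Ox) I e_perp'.
  rewrite dot_norm sqrtr_sqr normr_id -HNE// => /le_trans; apply.
  rewrite ler_wpM2l//; apply: ub_le_sup; last by exists x.
  have [cK KcK] := K_bounded.
  exists (Num.sqrt cK) => _ [y Oy <-]; rewrite HNE//.
  apply: le_trans (ler_wsqrtr (KcK y Oy)).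
  exact: (power_function_le dD (fun=> I) def (ev := ev) (k := K) I (kx y Oy)
    (kernel_vec_self K_sym H_rkhs Oy)).
have e_le : `|e| <= supPH * om * L2norm Omega p.
  (* For nonzero [e] one factor |e| is cancelled from |e|^2 <= |e| supPH om |p|. *)
  have [->|e0] := eqVneq e 0.
    by rewrite normr0 !mulr_ge0// L2norm_ge0.
  have [Le eom] := ev_L2 Omega_compact K_sym K_cont H_rkhs
    (mulr_ge0 (normr_ge0 e) supPH0) ev_e.
  rewrite -(@ler_pM2l _ `|e|) ?normr_gt0// -expr2 -dot_norm.
  have -> : dot e e = L2dot Omega (ev e) p.
    rewrite -(dot_integral_op Omega_compact K_sym K_cont H_rkhs K_bounded Lp vp).
    by rewrite {2}/e (dotBr dot_norm) (e_perp _ piS) subr0.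
  rewrite (le_trans (ler_norm _))// (le_trans (L2dot_le Le Lp))// !mulrA.
  by rewrite ler_wpM2r// L2norm_ge0.
have v_le : `|v - vN| <= (1 + M) * `|e| + Cg N * delta.
  have GAe : G N (A e) = - (v - e) + G N (A v).
    have -> : A e = (-1) *: A (v - e) + A v.
      by rewrite -A_linear scaleN1r opprB subrK.
    rewrite (G_lin _ _ _ _ N0N (A_data _) (A_data _)) scaleN1r.
    by congr (- _ + _); apply: GK => //; rewrite /e opprB addrC subrK.
  have Gb : G N (b - bdelta) = - vN + G N (A v).
    have -> : b - bdelta = (-1) *: bdelta + A v by rewrite scaleN1r addrC Avb.
    rewrite (G_lin _ _ _ _ N0N bD (A_data _)) scaleN1r.
    by congr (- _ + _); exact: esym.
  (* [G N (A v)] occurs in [GAe] and in [Gb] and cancels, which separates the approximation error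
     from the data error. *)
  have -> : v - vN = (e - G N (A e)) + G N (b - bdelta).
    rewrite GAe Gb; move: (G N (A v)) => GAv.
    rewrite opprD opprK [e + (_ + _)]addrA [e + (v - e)]addrC subrK.
    by rewrite [- vN + _]addrC addrA subrK.
  rewrite (le_trans (ler_normD _ _))// lerD//.
    rewrite (le_trans (ler_normB _ _))// mulrDl mul1r lerD//.
    exact: GM.
  by rewrite -deltaE; exact: (CgP N).2.
rewrite [leLHS]addrC lerD2r.
apply: le_trans (_ : cU * ((1 + M) * (supPH * om * L2norm Omega p) +
  Cg N * delta) <= _).
  rewrite ler_wpM2l ?(ltW cU0)// (le_trans v_le)// lerD2r ler_wpM2l//.
  by rewrite addr_ge0.
(* The units added to the constants leave exactly [delta + supPH * L2norm Omega p] as the difference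
   of the two sides. *)
have H1 : 0 <= supPH * L2norm Omega p by rewrite mulr_ge0// L2norm_ge0.
rewrite -subr_ge0; apply: le_trans (addr_ge0 delta0 H1) _.
by rewrite le_eqVlt; apply/orP; left; apply/eqP; ring.
Qed.
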